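(* Let $B$ be a densely defined closed symmetric operator with deficiency indices $(1,1)$ on a Hilbert space $\mathcal{H}$, with self-adjoint extensions $T_\theta$, $\theta\in[0,\pi)$, and let $\mathcal{M}$ be the cyclicity space of the deficiency vector $u_+$. Fix $\theta_0\in[0,\pi)$, let $\mathcal{E}^0$ be the spectral family of $T_{\theta_0}\upharpoonright_{\mathcal{M}}$, and let $\mu^0$ be the measure $d\mu^0(x)=(1+x^2)\,d\langle u_+,\mathcal{E}^0(x)u_+\rangle$. Then for each $\theta\in[0,\pi)$ with $\theta\ne\theta_0$, $$\sigma_p(T_\theta\upharpoonright_{\mathcal{M}})=\left\{y\in\mathbb{R} : \int_{\mathbb{R}}\frac{d\mu^0(x)}{(x-y)^2}<\infty,\ F_{\mu^0}(y+i0)=\cot(\theta-\theta_0)\right\}.$$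
   Context: $\mathcal{H}$ is a complex Hilbert space. The deficiency spaces of $B$ are $K_\pm(B)=\mathrm{Ran}(B\pm iI)^\perp=\mathrm{Ker}(B^*\mp iI)$, both one-dimensional; $u_\pm\in K_\pm(B)$ are fixed unit vectors, and $u_+$ is called the deficiency vector. For $\theta\in[0,\pi)$, $T_\theta$ is the self-adjoint extension of $B$ with domain $D(T_\theta)=D(B)\dotplus\mathrm{span}\{u_++e^{-2i\theta}u_-\}$ and $T_\theta(x+au_++ae^{-2i\theta}u_-)=Bx+aiu_+-aie^{-2i\theta}u_-$ for $x\in D(B)$, $a\in\mathbb{C}$. The cyclicity space of $u_+$ is $\mathcal{M}=\overline{\mathrm{span}\{(T_\theta-zI)^{-1}u_+:z\in\mathbb{C}\setminus\mathbb{R}\}}$; it does not depend on $\theta$ and reduces every $T_\theta$. $T_\theta\upharpoonright_{\mathcal{M}}$ is the self-adjoint operator on $\mathcal{M}$ with domain $D(T_\theta)\cap\mathcal{M}$. $\sigma_p$ denotes the set of eigenvalues. For a positive Borel measure $\mu$ on $\mathbb{R}$ with $\int\frac{d\mu(x)}{1+x^2}<\infty$, $F_\mu(z)=\int\left(\frac{1}{x-z}-\frac{x}{1+x^2}\right)d\mu(x)$ for $\mathrm{Im}\,z>0$, and $F_\mu(y+i0)=\lim_{\varepsilon\downarrow0}F_\mu(y+i\varepsilon)$. The integrand $(x-y)^{-2}$ is taken to be $+\infty$ at $x=y$. *)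

(* Defs.v *)
From HB Require Import structures.
From mathcomp Require Import all_boot all_order all_algebra.
From mathcomp Require Import all_classical all_reals all_analysis.
From mathcomp Require Import measurable_realfun.
From mathcomp Require Import complex.

Set Implicit Arguments.
Unset Strict Implicit.
Unset Printing Implicit Defensive.
Import Order.TTheory GRing.Theory Num.Def Num.Theory.
Import numFieldNormedType.Exports.
Local Open Scope classical_set_scope.
Local Open Scope ring_scope.
Local Open Scope complex_scope.

(* A complex Hilbert space: a Banach space over R[i] whose norm comes from a
   scalar product. The scalar product is linear in its first argument. *)
HB.mixin Record CompleteNormedModule_isHilbert (R : realType) H
    & CompleteNormedModule R[i] H := {
  dot : {dot H for (@conjC R[i])} ;
  sqr_norm_dot : forall x : H, `|x| ^+ 2 = dot x x }.

#[short(type="hilbertType")]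
HB.structure Definition Hilbert (R : realType) :=
  { H of CompleteNormedModule R[i] H & CompleteNormedModule_isHilbert R H }.

Section subspaces.
Context {R : realType} {H : hilbertType R}.
Implicit Types A K M : set H.

Definition lin_span A : set H :=
  [set v | exists n (c : 'I_n -> R[i]) (w : 'I_n -> H),
     (forall i, A (w i)) /\ v = \sum_i c i *: w i].

Definition orthocomplement A : set H :=
  [set v | forall w, A w -> dot v w = 0].

Definition one_dimensional K :=
  exists2 e : H, e != 0 & K = [set a *: e | a in [set: R[i]]].

End subspaces.

(* Unbounded operators in H are identified with their graphs: T (x, y) means
   that x is in the domain of T and that T x = y. *)
Section operators.
Context {R : realType} {H : hilbertType R}.
Implicit Types (T : set (H * H)) (z : R[i]) (M : set H).

Definition linear_operator T :=
  [/\ T (0, 0),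
      forall (a : R[i]) p q, T p -> T q -> T (a *: p + q) &
      forall x y y', T (x, y) -> T (x, y') -> y = y'].

Definition domain T : set H := [set x | exists y, T (x, y)].

Definition densely_defined T := dense (domain T).

Definition symmetric_operator T :=
  forall p q, T p -> T q -> dot p.2 q.1 = dot p.1 q.2.

(* Ran (T + z I) *)
Definition range_shift T z : set H :=
  [set w | exists2 p, T p & w = p.2 + z *: p.1].

(* graph of (T - z I)^-1 *)
Definition resolvent T z : set (H * H) :=
  [set p | exists2 q, T q & p = (q.2 - z *: q.1, q.1)].

Definition op_restrict T M : set (H * H) := [set p | T p /\ M p.1].

Definition point_spectrum T : set R[i] :=
  [set z | exists2 v, v != 0 & T (v, z *: v)].

End operators.

Section extensions.
Context {R : realType} {H : hilbertType R}.
Implicit Types (B : set (H * H)) (up um : H) (t : R).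

Definition deficiency_plus B : set H := orthocomplement (range_shift B 'i).

Definition deficiency_minus B : set H := orthocomplement (range_shift B (- 'i)).

(* e^(-2 i t) *)
Definition expN2i t : R[i] := cos (2 * t) -i* sin (2 * t).

(* the extension T_t of B *)
Definition extension B up um t : set (H * H) :=
  [set p | exists2 q, B q & exists a : R[i],
     p = (q.1 + a *: up + (a * expN2i t) *: um,
          q.2 + (a * 'i) *: up - (a * 'i * expN2i t) *: um)].

Definition cyclicity_space B up um t : set H :=
  closure (lin_span [set v | exists2 z : R[i], complex.Im z != 0 &
    resolvent (extension B up um t) z (up, v)]).

End extensions.

(* Resolution of the identity of a closed subspace M of H. An orthogonal
   projection of M is seen as an orthogonal projection of H with range in M, so
   that the E l all vanish on the orthogonal complement of M. *)
Record spectral_family (R : realType) (H : hilbertType R) (M : set H) := {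
  spectral_proj :> R -> {linear H -> H} ;
  spectral_proj_range : forall l v, M (spectral_proj l v) ;
  spectral_proj_sym : forall l v w,
    dot (spectral_proj l v) w = dot v (spectral_proj l w) ;
  spectral_proj_min : forall l k v,
    spectral_proj l (spectral_proj k v) = spectral_proj (minr l k) v ;
  spectral_proj_right_continuous : forall l v,
    spectral_proj k v @[k --> l^'+] --> spectral_proj l v ;
  spectral_proj_ninfty : forall v, spectral_proj k v @[k --> -oo] --> (0 : H) ;
  spectral_proj_pinfty : forall v, M v ->
    spectral_proj k v @[k --> +oo] --> v }.

Section spectral_measure.
Context {R : realType} {H : hilbertType R} {M : set H}.
Variables (E : spectral_family M) (v : H).

(* the function <v, E(x) v>; it is real-valued *)
Definition spectral_distr (x : R) : R := complex.Re (dot (E x v) v).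

Let spectral_distrB (l k : R) : l <= k ->
  (spectral_distr k - spectral_distr l)%:C = `|E k v - E l v| ^+ 2.
Proof.
move=> lk; rewrite sqr_norm_dot.
have dotE j i : dot (E j v) (E i v) = dot (E (minr j i) v) v.
  by rewrite -spectral_proj_sym spectral_proj_min minC.
rewrite linearBl linearBr/= linearBr/=.
rewrite !dotE !minxx (min_idPr lk) (min_idPl lk) subrr subr0.
have dotR j : dot (E j v) v = (complex.Re (dot (E j v) v))%:C.
  have := dnorm_ge0 dot (E j v); rewrite dotE minxx => ge0.
  by rewrite RRe_real// ger0_real.
by rewrite (dotR k) (dotR l) -rmorphB.
Qed.

Let spectral_distr_nd : nondecreasing spectral_distr.
Proof.
move=> l k lk; rewrite -subr_ge0 -lecR (spectral_distrB lk).
by rewrite exprn_ge0.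
Qed.

Let spectral_distr_rc : right_continuous spectral_distr.
Proof.
move=> l; apply/(@cvgrPdist_lt _ R^o) => e e0.
have se0 : 0 < (Num.sqrt e)%:C by rewrite ltcR sqrtr_gt0.
have /cvgrPdist_lt/(_ _ se0) := @spectral_proj_right_continuous _ _ _ E l v.
move=> Hlt; near=> k.
have lk : l <= k by near: k; exact: nbhs_right_ge.
rewrite distrC ger0_norm; last by rewrite subr_ge0 spectral_distr_nd.
rewrite -ltcR (spectral_distrB lk) -(sqr_sqrtr (ltW e0)) rmorphXn/=.
rewrite ltrXn2r//= distrC; first by near: k.
Unshelve. all: by end_near.
Qed.

HB.instance Definition _ :=
  isCumulative.Build R _ R spectral_distr spectral_distr_nd spectral_distr_rc.

(* the Borel measure d<v, E(x) v> *)
Definition spectral_measure : {measure set (measurableTypeR R) -> \bar R} :=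
  lebesgue_stieltjes_measure spectral_distr.

End spectral_measure.

(* E is the spectral family of A, i.e. A is the integral of x dE(x):
   D(A) consists of the v in M such that x^2 is d<v, E(x) v>-integrable, and
   <v, A v> is the integral of x d<v, E(x) v> for v in D(A). *)
Definition is_spectral_family_of (R : realType) (H : hilbertType R)
    (M : set H) (A : set (H * H)) (E : spectral_family M) :=
  domain A = [set v | M v /\
    (\int[spectral_measure E v]_x (x ^+ 2)%:E < +oo)%E] /\
  forall v w, A (v, w) -> dot w v = (\int[spectral_measure E v]_x x)%R%:C.

Section weighted_measure.
Context {R : realType}.
Variable nu : {measure set (measurableTypeR R) -> \bar R}.

(* (1 + x^2) dnu(x) *)
Definition weighted_measure (A : set (measurableTypeR R)) : \bar R :=
  (\int[nu]_(x in A) (1 + (x : R) ^+ 2)%:E)%E.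

Let weight_ge0 (x : R) : (0 <= (1 + x ^+ 2)%:E)%E.
Proof. by rewrite lee_fin addr_ge0// sqr_ge0. Qed.

Let measurable_weight : measurable_fun [set: measurableTypeR R]
  (EFin \o (fun x : R => 1 + x ^+ 2)).
Proof.
apply/measurable_EFinP; apply: measurable_funD => //.
Qed.

Let weighted_measure0 : weighted_measure set0 = 0%E.
Proof. exact: integral_set0. Qed.

Let weighted_measure_ge0 A : (0 <= weighted_measure A)%E.
Proof. exact: integral_ge0. Qed.

Let weighted_measure_sigma_additive : semi_sigma_additive weighted_measure.
Proof. exact: semi_sigma_additive_nng_induced. Qed.

HB.instance Definition _ := isMeasure.Build _ _ _ weighted_measure
  weighted_measure0 weighted_measure_ge0 weighted_measure_sigma_additive.

End weighted_measure.

Section borel_transform.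
Context {R : realType}.
Variable mu : {measure set (measurableTypeR R) -> \bar R}.

(* F_mu(z); the complex-valued integrand is integrated componentwise *)
Definition borel_transform (z : R[i]) : R[i] :=
  let f (x : R) : R[i] := (x%:C - z)^-1 - (x / (1 + x ^+ 2))%:C in
  (\int[mu]_x complex.Re (f x))%R +i* (\int[mu]_x complex.Im (f x))%R.

End borel_transform.

(* (x - y)^-2, with value +oo at x = y; the inverse of R sends 0 to 0 *)
Definition inv_sqr_dist {R : realType} (y x : R) : \bar R :=
  if x == y then +oo%E else ((x - y) ^- 2)%:E.

Definition cot {R : realType} (x : R) : R := cos x / sin x.

(* Main.v *)
Require Import Defs.
From HB Require Import structures.
From mathcomp Require Import all_boot all_order all_algebra.
From mathcomp Require Import all_classical all_reals all_analysis.
From mathcomp Require Import measurable_realfun.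
From mathcomp Require Import complex.
From mathcomp Require Import ring lra.
Import Order.TTheory GRing.Theory Num.Def Num.Theory.
Import numFieldNormedType.Exports.
Local Open Scope classical_set_scope.
Local Open Scope ring_scope.
Local Open Scope complex_scope.

(** Write u for u_+, T' for the extension of parameter t0, R(z) for its
    resolvent and F for the Borel transform of mu0. The proof reduces both
    sides of the equality to the existence of a vector g of D(T') with
    (T' - y) g = u, together with
    [[
      y + (1 + y^2) (g, u) = cot (t - t0).
    ]]

    On the operator side, the domains of B* and of the extensions are described
    by two coordinates on the deficiency vectors ([ext_graph]). If v is an
    eigenvector of T_t in M, its two coordinates are not both zero, since
    eigenvectors of B are orthogonal to M; a multiple of v has the form u + (y -
    i) g with g in D(T'), and then (T' - y) g = u. Conversely, for any such g
    the vector u + (y - i) g is an eigenvector of B* which satisfies the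
    boundary condition of T_t exactly when the displayed equation holds
    ([eigenvector_to_boundary_value], [boundary_value_to_eigenvector]). The
    resolvents needed here exist because the T_t are self-adjoint
    ([ext_self_adjoint], a consequence of the projection theorem), and Krein's
    formula shows that M is the same for all parameters
    ([resolvent_cyclicity_space]).

    On the measure side, let A be the part of T' in M. For v = R(z) u one has
    [[
      F(z) = z + (1 + z^2) (v, u)
    ]]
    and the integral of |x - z|^-2 against mu0 is the integral of 1 + x^2
    against the spectral measure of v ([borel_transform_resolvent],
    [integral_sqr_distV_resolvent]). Both follow from the fact that the spectral
    measure of (A - z) v has density |x - z|^2 with respect to that of v
    ([spectral_measure_image]). The spectral family is only known through the
    quadratic form (A v, v), so this fact takes two steps: the form splits along
    the spectral projections of bounded intervals ([dot_operator_orthogonal]),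
    and polarizing the spectral measures of p + w and p - w, where w is the
    image of p under A - l, recovers the norm of w from the quadratic form
    ([itv_proj_polarization], [hnorm_itv_proj_image]).

    The two sides meet at the real line. If g exists, the vectors R(y + i e) u
    stay bounded and their pairings with u converge to (g, u), which gives the
    finiteness of the integral of (x - y)^-2 and the value of F(y + i0)
    ([integral_inv_sqr_dist_lty], [borel_transform_limit]). If the integral is
    finite, the same vectors are bounded, their norms are monotone in e, and an
    explicit identity for their differences makes them converge to such a g
    ([resolvent_boundary_value]). *)

Set Implicit Arguments.
Unset Strict Implicit.
Unset Printing Implicit Defensive.

(** * Real-valued norms, scalar products *)

Section complex_facts.
Context {R : realType}.
Implicit Types (z w : R[i]) (a b : R).

Lemma ReD z w : complex.Re (z + w) = complex.Re z + complex.Re w.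
Proof. by case: z w => [? ?] [? ?]. Qed.
Lemma ImD z w : complex.Im (z + w) = complex.Im z + complex.Im w.
Proof. by case: z w => [? ?] [? ?]. Qed.
Lemma ReN z : complex.Re (- z) = - complex.Re z. Proof. by case: z. Qed.
Lemma ImN z : complex.Im (- z) = - complex.Im z. Proof. by case: z. Qed.
Lemma ReM z w : complex.Re (z * w) =
  complex.Re z * complex.Re w - complex.Im z * complex.Im w.
Proof. by case: z w => [? ?] [? ?]. Qed.
Lemma ImM z w : complex.Im (z * w) =
  complex.Re z * complex.Im w + complex.Im z * complex.Re w.
Proof. by case: z w => [? ?] [? ?]. Qed.
Lemma Re_conj z : complex.Re (conjC z) = complex.Re z. Proof. by case: z. Qed.
Lemma Im_conj z : complex.Im (conjC z) = - complex.Im z. Proof. by case: z. Qed.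

Lemma complex_ext z w :
  complex.Re z = complex.Re w -> complex.Im z = complex.Im w -> z = w.
Proof. by case: z w => [a b] [c d] /= -> ->. Qed.

(** The norm of [R[i]] takes its values in [R[i]]; the estimates below need the
    total order of [R]. *)
Definition modulus z : R := complex.Re `|z|.

Lemma modulusE z : `|z| = (modulus z)%:C.
Proof. by rewrite /modulus RRe_real// normr_real. Qed.
Lemma modulus_ge0 z : 0 <= modulus z.
Proof. by rewrite -ler0c -modulusE. Qed.
Lemma modulus_sqr z : modulus z ^+ 2 = complex.Re z ^+ 2 + complex.Im z ^+ 2.
Proof.
by apply: complexI; rewrite rmorphXn/= -modulusE add_Re2_Im2.
Qed.
Lemma modulusM z w : modulus (z * w) = modulus z * modulus w.
Proof. by apply: complexI; rewrite rmorphM/= -!modulusE normrM. Qed.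
Lemma modulus_real a : modulus a%:C = `|a|.
Proof. by apply: complexI; rewrite -modulusE normc_def/= expr0n/= addr0 sqrtr_sqr. Qed.
Lemma modulus_triangle z w : modulus (z + w) <= modulus z + modulus w.
Proof. by rewrite -lecR rmorphD/= -!modulusE ler_normD. Qed.
Lemma modulusN z : modulus (- z) = modulus z.
Proof. by rewrite /modulus normrN. Qed.
Lemma Re_le_modulus z : `|complex.Re z| <= modulus z.
Proof. by rewrite -lecR -modulusE normc_ge_Re. Qed.
Lemma Im_le_modulus z : `|complex.Im z| <= modulus z.
Proof.
rewrite -(@ler_pXn2r _ 2)// ?nnegrE ?modulus_ge0// modulus_sqr.
by rewrite real_normK ?num_real// lerDr sqr_ge0.
Qed.

End complex_facts.

Section hilbert_facts.
Context {R : realType} {H : hilbertType R}.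
Implicit Types (x y v w : H) (c : R[i]) (V : set H).

Lemma dotDl x y v : dot (x + y) v = dot x v + dot y v.
Proof. by rewrite linearDl. Qed.
Lemma dotNl x v : dot (- x) v = - dot x v.
Proof. by rewrite linearNl. Qed.
Lemma dotBl x y v : dot (x - y) v = dot x v - dot y v.
Proof. by rewrite linearBl. Qed.
Lemma dotZl c x v : dot (c *: x) v = c * dot x v.
Proof. by rewrite linearZl_LR. Qed.
Lemma dotDr x y v : dot v (x + y) = dot v x + dot v y.
Proof. by rewrite linearDr. Qed.
Lemma dotNr x v : dot v (- x) = - dot v x.
Proof. by rewrite linearNr. Qed.
Lemma dotBr x y v : dot v (x - y) = dot v x - dot v y.
Proof. by rewrite linearBr. Qed.
Lemma dotZr c x v : dot v (c *: x) = conjC c * dot v x.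
Proof. by rewrite linearZr_LR. Qed.
Lemma dot0l v : dot 0 v = 0. Proof. by rewrite linear0l. Qed.
Lemma dot0r v : dot v 0 = 0. Proof. by rewrite linear0r. Qed.
Lemma dot_conj x y : conjC (dot x y) = dot y x.
Proof. by rewrite [RHS]hermC/= expr0 mul1r. Qed.

Definition dotE := (dotDl, dotBl, dotZl, dotNl, dotDr, dotBr, dotZr, dotNr, dot0l, dot0r).

(** Same real-valued reading of the norm of [H] as [modulus] for [R[i]]. *)
Definition hnorm x : R := complex.Re `|x|.

Lemma hnormE x : `|x| = (hnorm x)%:C.
Proof. by rewrite /hnorm RRe_real// normr_real. Qed.
Lemma hnorm_ge0 x : 0 <= hnorm x.
Proof. by rewrite -ler0c -hnormE. Qed.
Lemma hnorm_triangle x y : hnorm (x + y) <= hnorm x + hnorm y.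
Proof. by rewrite -lecR rmorphD/= -!hnormE ler_normD. Qed.
Lemma hnormN x : hnorm (- x) = hnorm x.
Proof. by rewrite /hnorm normrN. Qed.
Lemma hnormB x y : hnorm (x - y) = hnorm (y - x).
Proof. by rewrite -hnormN opprB. Qed.
Lemma hnorm_triangle3 x y v : hnorm (x - y) <= hnorm (x - v) + hnorm (v - y).
Proof. by rewrite -{1}[x](subrK v) -addrA hnorm_triangle. Qed.
Lemma hnorm0 : hnorm 0 = 0. Proof. by rewrite /hnorm normr0. Qed.
Lemma hnormZ c x : hnorm (c *: x) = modulus c * hnorm x.
Proof. by apply: complexI; rewrite rmorphM/= -modulusE -!hnormE normrZ. Qed.
Lemma hnorm_eq0 x : hnorm x = 0 -> x = 0.
Proof. by move=> h; apply/eqP; rewrite -normr_eq0 hnormE h. Qed.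

Lemma dot_sqr x : dot x x = (hnorm x ^+ 2)%:C.
Proof. by rewrite -sqr_norm_dot hnormE rmorphXn. Qed.
Lemma hnorm_sqr x : hnorm x ^+ 2 = complex.Re (dot x x).
Proof. by rewrite dot_sqr. Qed.
Lemma dot_eq0 x : dot x x = 0 -> x = 0.
Proof.
rewrite dot_sqr => /(congr1 (@complex.Re R))/= /eqP.
by rewrite sqrf_eq0 => /eqP/hnorm_eq0.
Qed.

Lemma dot_ext x y : (forall w, dot x w = dot y w) -> x = y.
Proof.
move=> xy; apply/eqP; rewrite -subr_eq0; apply/eqP/dot_eq0.
by rewrite dotBl xy subrr.
Qed.

Lemma dot_ortho_sym x y : dot x y = 0 -> dot y x = 0.
Proof. by rewrite -(dot_conj x) => ->; rewrite rmorph0. Qed.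

Lemma Re_dotC x y : complex.Re (dot x y) = complex.Re (dot y x).
Proof. by rewrite -dot_conj Re_conj. Qed.

Lemma hnorm_sqrD x y :
  hnorm (x + y) ^+ 2 = hnorm x ^+ 2 + hnorm y ^+ 2 + 2 * complex.Re (dot x y).
Proof.
rewrite !hnorm_sqr !dotE !ReD (Re_dotC y x).
by ring.
Qed.

Lemma hnorm_sqrB x y :
  hnorm (x - y) ^+ 2 = hnorm x ^+ 2 + hnorm y ^+ 2 - 2 * complex.Re (dot x y).
Proof. by rewrite hnorm_sqrD hnormN dotNr ReN mulrN. Qed.

Lemma conjC_mul_modulus (z : R[i]) : conjC z * z = (modulus z ^+ 2)%:C.
Proof. by rewrite mulrC -normCK modulusE -rmorphXn. Qed.

(** Nonnegativity of the squared norm of (y,y) x - (x,y) y. *)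
Lemma cauchy_schwarz x y : modulus (dot x y) <= hnorm x * hnorm y.
Proof.
have [y0|yn0] := eqVneq (hnorm y) 0.
  by rewrite (hnorm_eq0 y0) dot0r hnorm0 mulr0 /modulus normr0.
have n0 : 0 < hnorm y ^+ 2 by rewrite exprn_even_gt0.
rewrite -(@ler_pXn2r _ 2)// ?nnegrE ?mulr_ge0 ?hnorm_ge0 ?modulus_ge0//.
rewrite exprMn -(ler_pM2r n0).
have := sqr_ge0 (hnorm (dot y y *: x - dot x y *: y)).
rewrite hnorm_sqrB !hnormZ !dotE.
rewrite conjC_mul_modulus.
rewrite dot_sqr -rmorphM/= modulus_real normrX ger0_norm ?hnorm_ge0// !exprMn.
nra.
Qed.

End hilbert_facts.

(** Identities between linear combinations become ring identities once both
    sides are paired with an arbitrary vector. *)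
Ltac module_ring := apply: dot_ext => ?; rewrite !dotE; ring.

(** * Convergence of sequences and the projection theorem *)

Section hilbert_topology.
Context {R : realType} {H : hilbertType R}.
Implicit Types (x y h l : H) (c : R[i]) (V : set H) (v w : nat -> H).

Lemma invS_lt (e : R) : 0 < e ->
  exists N, forall n, (N <= n)%N -> n.+1%:R^-1 < e.
Proof.
move=> e0; have [N _ NP] := near_infty_natSinv_lt (PosNum e0).
by exists N => n Nn; apply: NP.
Qed.

(** Closedness and completeness are only ever used along sequences. *)
Definition hlim v l :=
  forall e : R, 0 < e -> exists N, forall n, (N <= n)%N -> hnorm (v n - l) < e.

Lemma hlim_cvg v l : hlim v l -> v n @[n --> \oo] --> l.
Proof.
move=> vl; apply/cvgrPdist_lt => e e0.
have er : e = (complex.Re e)%:C by rewrite RRe_real// gtr0_real.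
have [|N NP] := vl (complex.Re e); first by rewrite -ltcR -er.
exists N => // n /= Nn; rewrite distrC hnormE er ltcR.
exact: NP.
Qed.

Definition seq_closed V :=
  forall v l, (forall n, V (v n)) -> hlim v l -> V l.

Lemma closed_seq_closed V : closed V -> seq_closed V.
Proof.
move=> cV v l Vv /hlim_cvg; apply: (closed_cvg _ cV).
exact: nearW.
Qed.

Definition graph_closed (A : set (H * H)) := forall v w l k,
  (forall n, A (v n, w n)) -> hlim v l -> hlim w k -> A (l, k).

Lemma closed_graph_closed (A : set (H * H)) : closed A -> graph_closed A.
Proof.
move=> cA v w l k Avw /hlim_cvg vl /hlim_cvg wk.
have vw : (v n, w n) @[n --> \oo] --> (l, k) by exact: cvg_pair.
by apply: (closed_cvg _ cA _ _ vw); exact: nearW.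
Qed.

Lemma hilbert_complete v :
  (forall e : R, 0 < e -> exists N, forall m n, (N <= m)%N -> (N <= n)%N ->
     hnorm (v m - v n) < e) ->
  exists l, hlim v l.
Proof.
move=> vC; have cv : cvg (v n @[n --> \oo]).
  apply: cauchy_cvg; apply: cauchy_exP => e e0.
  have er : e = (complex.Re e)%:C by rewrite RRe_real// gtr0_real.
  have [|N NP] := vC (complex.Re e); first by rewrite -ltcR -er.
  exists (v N); exists N => // n /= Nn.
  by rewrite -ball_normE/= hnormE er ltcR; exact: NP.
exists (lim (v n @[n --> \oo])) => e e0.
have ec0 : 0 < e%:C :> R[i] by rewrite ltcR.
have /cvgrPdist_lt/(_ _ ec0)[N _ NP] := cv.
by exists N => n Nn; rewrite -ltcR -hnormE distrC; exact: NP.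
Qed.

Lemma hlim_cauchy v l : hlim v l -> forall e : R, 0 < e ->
  exists N, forall m n, (N <= m)%N -> (N <= n)%N -> hnorm (v m - v n) < e.
Proof.
move=> vl e e0; have [|N NP] := vl (e / 2); first by rewrite divr_gt0.
exists N => m n /NP mN /NP nN.
by rewrite (le_lt_trans (hnorm_triangle3 _ _ l))// [hnorm (l - _)]hnormB; lra.
Qed.

Lemma hlimD v w l k : hlim v l -> hlim w k -> hlim (fun n => v n + w n) (l + k).
Proof.
move=> vl wk e e0; have e2 : 0 < e / 2 by rewrite divr_gt0.
have [N NP] := vl _ e2; have [M MP] := wk _ e2.
exists (maxn N M) => n; rewrite geq_max => /andP[/NP nN /MP nM].
rewrite opprD addrACA (le_lt_trans (hnorm_triangle _ _))//; lra.
Qed.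

Lemma hlimZ c v l : hlim v l -> hlim (fun n => c *: v n) (c *: l).
Proof.
move=> vl e e0; have c1 : 0 < modulus c + 1 by rewrite ltr_wpDl ?modulus_ge0.
have [|N NP] := vl (e / (modulus c + 1)); first by rewrite divr_gt0.
exists N => n /NP; rewrite ltr_pdivlMr// => ve; rewrite -scalerBr hnormZ.
have := hnorm_ge0 (v n - l); nra.
Qed.

Lemma hlim_cst l : hlim (fun=> l) l.
Proof. by move=> e e0; exists 0 => n _; rewrite subrr hnorm0. Qed.

Lemma hlim_dot v l x : hlim v l -> forall e : R, 0 < e ->
  exists N, forall n, (N <= n)%N -> modulus (dot x (v n) - dot x l) < e.
Proof.
move=> vl e e0; have c1 : 0 < hnorm x + 1 by rewrite ltr_wpDl ?hnorm_ge0.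
have [|N NP] := vl (e / (hnorm x + 1)); first by rewrite divr_gt0.
exists N => n /NP; rewrite ltr_pdivlMr// => ve.
have := cauchy_schwarz x (v n - l); rewrite dotBr.
have := hnorm_ge0 (v n - l); have := hnorm_ge0 x; nra.
Qed.

Lemma closureP_hnorm V x :
  closure V x <-> forall e : R, 0 < e -> exists2 y, V y & hnorm (x - y) < e.
Proof.
split=> [Vx e e0|Vx A].
  have ec0 : 0 < e%:C :> R[i] by rewrite ltcR.
  have [y [Vy]] := Vx _ (nbhsx_ballx x _ ec0).
  by rewrite -ball_normE/= hnormE ltcR; exists y.
move=> /nbhs_ballP[e /= e0 xeA].
have er : e = (complex.Re e)%:C by rewrite RRe_real// gtr0_real.
have [|y Vy xy] := Vx (complex.Re e); first by rewrite -ltcR -er.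
by exists y; split => //; apply: xeA; rewrite -ball_normE/= hnormE er ltcR.
Qed.

Lemma hlim_dist v l h (r : R) : hlim v l ->
  (forall e, 0 < e -> exists N, forall n, (N <= n)%N -> hnorm (h - v n) < r + e) ->
  hnorm (h - l) <= r.
Proof.
move=> vl vr; apply/ler_addgt0Pr => e e0.
have e20 : 0 < e / 2 by rewrite divr_gt0.
have [N1 N1P] := vl _ e20; have [N2 N2P] := vr _ e20.
have := N1P _ (leq_maxl N1 N2); have := N2P _ (leq_maxr N1 N2).
have := hnorm_triangle3 h l (v (maxn N1 N2)).
lra.
Qed.

Definition subspace (U : lmodType R[i]) (V : set U) :=
  V 0 /\ forall c (x y : U), V x -> V y -> V (c *: x + y).

Lemma subspaceD (U : lmodType R[i]) (V : set U) (x y : U) :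
  subspace V -> V x -> V y -> V (x + y).
Proof. by move=> [_ VL] Vx Vy; rewrite -[x]scale1r; exact: VL. Qed.

Lemma subspaceZ (U : lmodType R[i]) (V : set U) c (x : U) :
  subspace V -> V x -> V (c *: x).
Proof. by move=> [V0 VL] Vx; rewrite -[_ *: _]addr0; exact: VL. Qed.

Lemma subspaceB (U : lmodType R[i]) (V : set U) (x y : U) :
  subspace V -> V x -> V y -> V (x - y).
Proof.
by move=> VS Vx Vy; rewrite -scaleN1r; apply: subspaceD => //; exact: subspaceZ.
Qed.

Lemma closure_subspace V : subspace V -> subspace (closure V).
Proof.
move=> VS; split; first exact/subset_closure/VS.1.
move=> c x y /closureP_hnorm Vx /closureP_hnorm Vy; apply/closureP_hnorm => e e0.
have e2 : 0 < e / 2 by rewrite divr_gt0.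
have c1 : 0 < modulus c + 1 by rewrite ltr_wpDl ?modulus_ge0.
have [y' Vy' yy'] := Vy _ e2.
have [|x' Vx'] := Vx (e / 2 / (modulus c + 1)); first by rewrite divr_gt0.
rewrite ltr_pdivlMr// => xx'; exists (c *: x' + y'); first exact: VS.2.
rewrite opprD addrACA -scalerBr (le_lt_trans (hnorm_triangle _ _))// hnormZ.
have := hnorm_ge0 (x - x'); nra.
Qed.

(** By the parallelogram law a minimizing sequence for the distance from [h] to
    [V] is Cauchy; its limit is the foot of the perpendicular, since moving it
    in a direction of [V] cannot shorten the distance. *)
Lemma projection_theorem V h : subspace V -> seq_closed V ->
  exists2 x, V x & orthocomplement V (h - x).
Proof.
move=> [V0 VL] cV.
have VN c x y : V x -> V y -> V (x + c *: y) by rewrite addrC => *; exact: VL.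
pose S := [set hnorm (h - x) | x in V].
have hS : has_inf S.
  split; first by exists (hnorm (h - 0)), 0.
  by exists 0 => _ [x _ <-]; exact: hnorm_ge0.
pose d := inf S.
have dle x : V x -> d <= hnorm (h - x).
  by move=> Vx; apply: ge_inf; [exact: hS.2 | exists x].
have d0 : 0 <= d.
  by apply: lb_le_inf; [exact: hS.1 | move=> _ [x _ <-]; exact: hnorm_ge0].
have /choice[v vP] : forall n : nat, exists x, V x /\ hnorm (h - x) < d + n.+1%:R^-1.
  move=> n; have n0 : 0 < n.+1%:R^-1 :> R by rewrite invr_gt0.
  by have [_ [x Vx <-] xP] := inf_adherent n0 hS; exists x.
have [l vl] : exists l, hlim v l.
  apply: hilbert_complete => e e0.
  (* two points of [V] at distance less than d + a and d + b from h, with a and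
     b at most 1, are at squared distance at most (4 d + 2) (a + b) *)
  have e1 : 0 < Num.min 1 (e ^+ 2 / (8 * d + 8)).
    by rewrite lt_min ltr01 divr_gt0// ?exprn_gt0//; lra.
  have [N NP] := invS_lt e1; exists N => m n /NP m1 /NP n1.
  rewrite -(@ltr_pXn2r _ 2)// ?nnegrE ?hnorm_ge0 ?ltW//.
  have mid : V (2^-1 *: (v m + v n)).
    rewrite scalerDr -[X in _ + X]addr0; apply: (VL); first exact: (vP m).1.
    by apply: (VL) => //; exact: (vP n).1.
  have := dle _ mid.
  have := hnorm_sqrD (h - v m) (h - v n).
  have := hnorm_sqrB (h - v m) (h - v n).
  rewrite opprB [_ - _ + (_ - _)]addrC subrKA (hnormB (v n)).
  have -> : h - v m + (h - v n) = 2 *: (h - 2^-1 *: (v m + v n)).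
    rewrite scalerBr scalerA divff ?pnatr_eq0// scale1r scaler_nat mulr2n.
    by rewrite opprD addrACA.
  rewrite hnormZ.
  have -> : modulus (2 : R[i]) = 2.
    by rewrite -[2 : R[i]](rmorph_nat (real_complex R) 2) modulus_real ger0_norm.
  have := (vP m).2; have := (vP n).2.
  have := hnorm_ge0 (h - v m); have := hnorm_ge0 (h - v n).
  move: m1 n1.
  have am : 0 < m.+1%:R^-1 :> R by rewrite invr_gt0.
  have an : 0 < n.+1%:R^-1 :> R by rewrite invr_gt0.
  move: am an; rewrite !lt_min !ltr_pdivlMr; last 2 first.
  - lra.
  - lra.
  set a := m.+1%:R^-1; set b := n.+1%:R^-1.
  set p := hnorm (h - v m); set q := hnorm (h - v n).
  set r := hnorm (h - _); set s := hnorm _; set t := complex.Re _.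
  move=> a0 b0 /andP[a1 ae] /andP[b1 be] q0 p0 qb pa E2 E1 dr.
  have p2 : p ^+ 2 <= (d + a) ^+ 2 by rewrite ler_pXn2r// ?nnegrE; lra.
  have q2 : q ^+ 2 <= (d + b) ^+ 2 by rewrite ler_pXn2r// ?nnegrE; lra.
  have r2 : d ^+ 2 <= r ^+ 2 by rewrite ler_pXn2r// ?nnegrE; lra.
  have a2 : a ^+ 2 <= a by rewrite expr2 ger_pMl ?ltW.
  have b2 : b ^+ 2 <= b by rewrite expr2 ger_pMl ?ltW.
  lra.
have Vl : V l by apply: cV vl => n; exact: (vP n).1.
exists l => // y Vy.
have hl : hnorm (h - l) <= d.
  apply: hlim_dist vl _ => e e0; have [N NP] := invS_lt e0.
  exists N => n /NP ne; by rewrite (lt_trans (vP n).2)// ltrD2l.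
have [y0|yn0] := eqVneq (hnorm y) 0; first by rewrite (hnorm_eq0 y0) dot0r.
have n0 : 0 < hnorm y ^+ 2 by rewrite exprn_even_gt0.
pose c := dot (h - l) y.
(* compare with the foot of the perpendicular from h on the line l + C y *)
have := dle (l + ((hnorm y ^+ 2)^-1)%:C * c *: y) (VN _ _ _ Vl Vy).
move=> /(le_trans hl).
rewrite -(@ler_pXn2r _ 2)// ?nnegrE ?hnorm_ge0//.
rewrite opprD addrA (hnorm_sqrB (h - l)) hnormZ modulusM modulus_real.
rewrite dotZr rmorphM/= -[_ * _ * dot _ _]mulrA -/c conjC_mul_modulus.
have -> : conjC ((hnorm y ^+ 2)^-1)%:C = ((hnorm y ^+ 2)^-1)%:C :> R[i].
  exact: conjc_real.
rewrite -rmorphM/= !exprMn real_normK ?num_real//.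
set n := hnorm y ^+ 2 in n0 *; set k := modulus c ^+ 2.
have -> : n^-1 ^+ 2 * k * n = n^-1 * k by field; lra.
move=> hk; have : n^-1 * k <= 0 by lra.
rewrite pmulr_rle0 ?invr_gt0// => k0.
have := sqr_ge0 (modulus c); rewrite -/k => k1.
have /eqP : k = 0 by lra.
rewrite sqrf_eq0 => /eqP c0.
by apply/eqP; rewrite -normr_eq0 modulusE -/c c0.
Qed.

End hilbert_topology.

(** * Symmetric and self-adjoint operators *)

Section self_adjoint_operators.
Context {R : realType} {H : hilbertType R}.
Implicit Types (T : set (H * H)) (x y f g h : H) (c z : R[i]).

Lemma conjCi : conjC 'i%C = - 'i%C :> R[i].
Proof. by apply: complex_ext; rewrite ?Re_conj ?Im_conj/= ?oppr0. Qed.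

Lemma symmetric_real T x y : symmetric_operator T -> T (x, y) ->
  complex.Im (dot y x) = 0.
Proof.
move=> TS p; have /= := TS _ _ p p => e.
by have := congr1 (@complex.Im R) e; rewrite -[dot x y]dot_conj Im_conj; lra.
Qed.

(** As (T x, x) is real, the imaginary part of ((T - z) x, x) is - Im z |x|^2. *)
Lemma symmetric_shift_ge T z x y : symmetric_operator T -> T (x, y) ->
  `|complex.Im z| * hnorm x <= hnorm (y - z *: x).
Proof.
move=> TS p; have [x0|xn0] := eqVneq (hnorm x) 0.
  by rewrite x0 mulr0 hnorm_ge0.
have x0 : 0 < hnorm x by rewrite lt_def xn0 hnorm_ge0.
rewrite -(ler_pM2r x0) (le_trans _ (cauchy_schwarz _ _))//.
rewrite (le_trans _ (Im_le_modulus _))// !dotE ImD ImN (symmetric_real TS p).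
rewrite dot_sqr ImM/= mulr0 !add0r normrN normrM normrX.
by rewrite (ger0_norm (hnorm_ge0 x)) expr2 mulrA.
Qed.

Lemma symmetric_eigenvalue_real T z x : symmetric_operator T ->
  T (x, z *: x) -> x != 0 -> complex.Im z = 0.
Proof.
move=> TS p /eqP xn0; have := symmetric_shift_ge z TS p.
rewrite subrr hnorm0 => le0; apply/eqP; rewrite -normr_eq0.
have [//|z0] := eqVneq `|complex.Im z| 0.
have zp : 0 < `|complex.Im z| by rewrite lt_def z0 normr_ge0.
case: xn0; apply: hnorm_eq0; apply/eqP; rewrite eq_le hnorm_ge0 andbT.
by rewrite -(ler_pM2l zp) mulr0.
Qed.

Lemma range_shift_subspace T z : subspace T -> subspace (range_shift T z).
Proof.
move=> [T0 TL]; split.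
  by exists (0, 0) => //=; rewrite scaler0 addr0.
move=> c _ _ [[x y] p ->] [[x' y'] p' ->]; exists (c *: x + x', c *: y + y').
  exact: TL p p'.
by rewrite /= !scalerDr !scalerA addrACA mulrC.
Qed.

(** [symmetric_shift_ge] makes the preimages of a convergent sequence of the
    range a Cauchy sequence. *)
Lemma range_shift_closed T z : subspace T -> symmetric_operator T ->
  graph_closed T -> complex.Im z != 0 -> seq_closed (range_shift T z).
Proof.
move=> TL TS TC z0 f l fP fl.
have zp : 0 < `|complex.Im z| by rewrite normr_gt0.
have /choice[p pP] : forall n, exists p, T p /\ f n = p.2 + z *: p.1.
  by move=> n; have [p] := fP n; exists p.
have [a xa] : exists a, hlim (fun n => (p n).1) a.
  apply: hilbert_complete => e e0.
  have [N NP] := hlim_cauchy fl (mulr_gt0 zp e0).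
  exists N => m n mN nN; rewrite -(ltr_pM2l zp).
  apply: le_lt_trans (NP _ _ mN nN).
  have pm : T ((p m).1, (p m).2) by case: (p m) (pP m) => ? ? [].
  have pn : T ((p n).1, (p n).2) by case: (p n) (pP n) => ? ? [].
  have := symmetric_shift_ge (- z) TS (subspaceB TL pm pn).
  rewrite ImN normrN => /le_trans; apply.
  by rewrite scaleNr opprK (pP m).2 (pP n).2 scalerBr opprD addrACA.
exists (a, l - z *: a); last by rewrite /= subrK.
apply: (TC (fun n => (p n).1) (fun n => (p n).2)) => //.
  by move=> n; case: (p n) (pP n) => ? ? [].
have -> : (fun n => (p n).2) = (fun n => f n + (- z) *: (p n).1).
  by apply/funext => n; rewrite (pP n).2 scaleNr addrK.
by rewrite -scaleNr; apply: hlimD => //; exact: hlimZ.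
Qed.

(** The basic criterion for self-adjointness: it is what the von Neumann
    decomposition gives directly, and [self_adjoint_mem] recovers from it that
    the adjoint of [T] is contained in [T]. *)
Definition self_adjoint T := [/\ subspace T, symmetric_operator T,
  forall f, range_shift T 'i%C f & forall f, range_shift T (- 'i%C) f].

(** If (T + i) k = h + i g, then g - k is orthogonal to the range of T - i,
    which is the whole space. *)
Lemma self_adjoint_mem T g h : self_adjoint T ->
  (forall x y, T (x, y) -> dot y g = dot x h) -> T (g, h).
Proof.
move=> [TL TS Tp Tm] gh.
have [[k k'] Tk /= kE] := Tp (h + 'i%C *: g).
have [[x y] Txy /= xyE] := Tm (g - k).
suff /eqP : g - k = 0.
  rewrite subr_eq0 => /eqP gk.
  suff -> : h = k' by rewrite gk.
  by move: kE; rewrite gk => /addIr.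
apply: dot_eq0; rewrite [X in dot X _]xyE.
have /= s := TS _ _ Txy Tk; have e := gh _ _ Txy.
have := congr1 (dot x) kE; rewrite !dotE conjCi e s => /eqP.
by rewrite -subr_eq0 => /eqP E; rewrite -[RHS]E; ring.
Qed.

Lemma self_adjoint_closed T : self_adjoint T -> graph_closed T.
Proof.
move=> TA v w l k Tvw vl wk; apply: self_adjoint_mem => // x y Txy.
have [TL TS _ _] := TA.
apply/eqP; rewrite -subr_eq0; apply/eqP.
apply/eqP; rewrite -normr_eq0 modulusE; apply/eqP; congr (_%:C).
apply/eqP; rewrite eq_le modulus_ge0 andbT; apply/ler_addgt0Pr => e e0.
rewrite add0r; have e2 : 0 < e / 2 by rewrite divr_gt0.
have [N NP] := hlim_dot y vl e2; have [M MP] := hlim_dot x wk e2.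
have := NP _ (leq_maxl N M); have := MP _ (leq_maxr N M).
set n := maxn N M; have /= s := TS _ _ Txy (Tvw n).
have -> : dot y l - dot x k =
    - (dot y (v n) - dot y l) + (dot x (w n) - dot x k) by rewrite s; ring.
have := modulus_triangle (- (dot y (v n) - dot y l)) (dot x (w n) - dot x k).
by rewrite modulusN; lra.
Qed.

(** The range of T - z is closed, and a vector orthogonal to it is an
    eigenvector of [T] for the conjugate of [z], hence zero. *)
Lemma self_adjoint_range T z f : self_adjoint T -> complex.Im z != 0 ->
  exists x, T (x, f + z *: x).
Proof.
move=> TA z0; have [TL TS Tp Tm] := TA.
have Nz0 : complex.Im (- z) != 0 by rewrite ImN oppr_eq0.
have [_ [[x y] Txy ->] fx] := projection_theorem f (range_shift_subspace (- z) TL)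
  (range_shift_closed TL TS (self_adjoint_closed TA) Nz0).
move: fx; rewrite /= scaleNr; set d := f - _ => fx.
have Td : T (d, conjC z *: d).
  apply: self_adjoint_mem => // a b Tab.
  have := dot_ortho_sym (fx _ (ex_intro2 _ _ (a, b) Tab erefl)).
  rewrite /= !dotE mulNr => /eqP; rewrite subr_eq0 => /eqP ->.
  have -> : conjC (conjC z) = z by exact: conjcK.
  by [].
exists x; suff d0 : d = 0.
  by move/eqP: d0; rewrite /d subr_eq0 => /eqP ->; rewrite subrK.
apply/eqP; apply: contraNT z0 => dn0.
have := symmetric_eigenvalue_real TS Td dn0.
by rewrite -oppr_eq0 -Im_conj => ->.
Qed.

End self_adjoint_operators.

(** * Self-adjoint extensions and the cyclicity space *)

Section linear_span.
Context {R : realType} {H : hilbertType R}.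

Lemma lin_span_subspace (A : set H) : subspace (lin_span A).
Proof.
split; first by exists 0%N, (fun=> 0), (fun=> 0); split; [case | rewrite big_ord0].
move=> c _ _ [n [a [v [Av ->]]]] [m [b [w [Aw ->]]]].
exists (n + m)%N.
exists (fun i => match fintype.split i with inl j => c * a j | inr k => b k end).
exists (fun i => match fintype.split i with inl j => v j | inr k => w k end).
split=> [i|]; first by case: fintype.split.
rewrite big_split_ord/=; congr (_ + _); last first.
  by apply: eq_bigr => i _; rewrite -[rshift _ _]/(unsplit (inr i)) unsplitK.
rewrite scaler_sumr; apply: eq_bigr => i _.
by rewrite -[lshift _ _]/(unsplit (inl i)) unsplitK scalerA.
Qed.

Lemma sub_lin_span (A : set H) : A `<=` lin_span A.
Proof.
move=> v Av; exists 1%N, (fun=> 1), (fun=> v); split=> //.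
by rewrite big_ord1 scale1r.
Qed.

End linear_span.

Section cotangent.
Context {R : realType}.
Implicit Types t : R.

Lemma sin_neq0_range t t' : 0 <= t < pi -> 0 <= t' < pi -> t <> t' ->
  sin (t - t') != 0.
Proof.
have pos s s' : 0 <= s -> s' < pi -> s < s' -> 0 < sin (s' - s).
  by move=> s0 s'pi ss'; apply: sin_gt0_pi; lra.
move=> /andP[t0 tpi] /andP[t'0 t'pi] /eqP; rewrite neq_lt => /orP[tt'|t't].
  by rewrite -opprB sinN oppr_eq0 gt_eqF// pos.
by rewrite gt_eqF// pos.
Qed.

(** With p = t + t' and d = t - t', the factor exp(- i p) comes out of both
    sides, which reduce to 2 i cos d exp(- i p). *)
Lemma cot_expN2i t t' : sin (t - t') != 0 ->
  (cot (t - t'))%:C * (expN2i t' - expN2i t) = 'i%C * (expN2i t + expN2i t').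
Proof.
move=> s0; rewrite /cot.
have -> : expN2i t = cos (t + t' + (t - t')) -i* sin (t + t' + (t - t')).
  by rewrite /expN2i; congr (cos _ -i* sin _); ring.
have -> : expN2i t' = cos (t + t' - (t - t')) -i* sin (t + t' - (t - t')).
  by rewrite /expN2i; congr (cos _ -i* sin _); ring.
move: (t + t') (t - t') s0 => p d d0.
rewrite (cosD p d) (cosB p d) (sinD p d) (sinB p d).
by apply: complex_ext; rewrite !(ReM, ImM, ReD, ImD, ReN, ImN)/=; field.
Qed.

End cotangent.

Section extensions.
Context {R : realType} {H : hilbertType R} (B : set (H * H)) (up um : H).
Hypothesis B_linear : subspace B.
Hypothesis B_dense : densely_defined B.
Hypothesis B_closed : graph_closed B.
Hypothesis B_symmetric : symmetric_operator B.
Hypothesis defect_plus : one_dimensional (deficiency_plus B).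
Hypothesis defect_minus : one_dimensional (deficiency_minus B).
Hypothesis up_defect : deficiency_plus B up.
Hypothesis up_unit : hnorm up = 1.
Hypothesis um_defect : deficiency_minus B um.
Hypothesis um_unit : hnorm um = 1.
Implicit Types (a b c z : R[i]) (g h x y : H) (t : R).

Local Notation T := (extension B up um).
Local Notation e := (@expN2i R).

(** The graph of the adjoint of [B], whose domain is D(B) + span(up, um) by von
    Neumann's formula: [a] and [b] are the coordinates on the deficiency
    vectors, and the extension of parameter [t] is the part b = a exp(- 2 i t). *)
Definition ext_graph a b g h := exists2 q, B q &
  g = q.1 + a *: up + b *: um /\ h = q.2 + (a * 'i%C) *: up - (b * 'i%C) *: um.

(** The imaginary unit in [deficiency_minus] and [extension] is the one of
    abstract closed fields, which equals the pair (0, 1) by a lemma only. *)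
Lemma deficiency_minusE :
  deficiency_minus B = orthocomplement (range_shift B (- 'i%C)).
Proof. by rewrite /deficiency_minus complexiE. Qed.

Lemma extensionE t g h : T t (g, h) <-> exists a, ext_graph a (a * e t) g h.
Proof.
rewrite /extension /ext_graph complexiE.
split=> [[q Bq [a [-> ->]]]|[a [q Bq [-> ->]]]]; last first.
  by exists q => //; exists a; rewrite mulrAC.
by exists a, q => //; split => //; rewrite mulrAC.
Qed.

Lemma ext_graph_lin c a b a' b' g h g' h' :
  ext_graph a b g h -> ext_graph a' b' g' h' ->
  ext_graph (c * a + a') (c * b + b') (c *: g + g') (c *: h + h').
Proof.
move=> [q Bq [-> ->]] [q' Bq' [-> ->]]; exists (c *: q + q'); first exact: B_linear.2.
split=> /=.
  rewrite !scalerDl !scalerDr !scalerA addrACA; congr (_ + _).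
  exact: addrACA.
rewrite !mulrDl !scalerDl !scalerDr scalerN !scalerA !mulrA opprD addrACA.
by congr (_ + _); exact: addrACA.
Qed.

Lemma ext_graph_up : ext_graph 1 0 up ('i%C *: up).
Proof.
exists (0, 0); first exact: B_linear.1.
by rewrite /= mul0r !mul1r !scale0r scale1r subr0 addr0 !add0r.
Qed.

Lemma symmetric_dot_up q : B q -> dot q.2 up = - 'i%C * dot q.1 up.
Proof.
move=> Bq; have := up_defect (ex_intro2 _ _ q Bq erefl).
move/dot_ortho_sym; rewrite !dotE mulNr => /eqP.
by rewrite addr_eq0 => /eqP.
Qed.

Lemma symmetric_dot_um q : B q -> dot q.2 um = 'i%C * dot q.1 um.
Proof.
move=> Bq; have := um_defect.
rewrite deficiency_minusE => /(_ _ (ex_intro2 _ _ q Bq erefl)).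
move/dot_ortho_sym; rewrite !dotE mulNr => /eqP.
by rewrite subr_eq0 => /eqP.
Qed.

Lemma dot_up : dot up up = 1.
Proof. by rewrite dot_sqr up_unit expr1n. Qed.

Lemma dot_um : dot um um = 1.
Proof. by rewrite dot_sqr um_unit expr1n. Qed.

(** [up] is orthogonal to the range of B + i, so pairing with it reads off the
    coordinate [a]. *)
Lemma ext_graph_coef_up a b g h : ext_graph a b g h ->
  dot (h + 'i%C *: g) up = 2 * 'i%C * a.
Proof.
move=> [q Bq [-> ->]]; rewrite !dotE symmetric_dot_up// dot_up.
by ring.
Qed.

(** Green's formula: the boundary form has signature (1, 1) in the coordinates
    [(a, b)], so it vanishes where |a| = |b|, which gives symmetry. *)
Lemma ext_graph_green a b g h a' b' g' h' :
  ext_graph a b g h -> ext_graph a' b' g' h' ->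
  dot h g' - dot g h' = 2 * 'i%C * (a * conjC a' - b * conjC b').
Proof.
move=> [q Bq [-> ->]] [q' Bq' [-> ->]].
rewrite !dotE !rmorphM/= conjCi dot_up dot_um (B_symmetric Bq Bq').
rewrite !symmetric_dot_up// !symmetric_dot_um//.
have := symmetric_dot_up Bq'; have := symmetric_dot_um Bq'.
move=> /(congr1 conjC) + /(congr1 conjC).
rewrite !rmorphM/= rmorphN/= conjCi opprK !dot_conj => -> ->.
by ring.
Qed.

Lemma expN2i_unit t : e t * conjC (e t) = 1.
Proof.
apply: complex_ext; rewrite /expN2i ?ReM ?ImM Re_conj Im_conj/=; last by ring.
by rewrite -[RHS](cos2Dsin2 (2 * t)); ring.
Qed.

Lemma ext_symmetric t : symmetric_operator (T t).
Proof.
move=> [g h] [g' h'] /extensionE[a G] /extensionE[a' G'] /=.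
apply/eqP; rewrite -subr_eq0 (ext_graph_green G G') rmorphM/=.
by rewrite mulrACA expN2i_unit mulr1 subrr mulr0.
Qed.

Lemma ext_subspace t : subspace (T t).
Proof.
split.
  apply/extensionE; exists 0; exists (0, 0); first exact: B_linear.1.
  by rewrite /= !mul0r !scale0r subr0 !addr0.
move=> c [g h] [g' h'] /extensionE[a G] /extensionE[a' G'].
apply/extensionE; exists (c * a + a').
by rewrite mulrDl -mulrA; exact: ext_graph_lin.
Qed.

Lemma sub_ext t q : B q -> T t q.
Proof.
move=> Bq; exists q => //; exists 0.
by rewrite !mul0r !scale0r !addr0 subr0; case: q Bq.
Qed.

Lemma one_dimensional_span (K : set H) v w : one_dimensional K -> K v -> v != 0 ->
  K w -> exists c, w = c *: v.
Proof.
move=> [u _ ->] [a _ <-] au0 [b _ <-]; exists (b / a).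
rewrite scalerA divfK//; apply: contraNneq au0 => ->.
by rewrite scale0r.
Qed.

Lemma neq0_unit v : hnorm v = 1 -> v != 0 :> H.
Proof.
move=> v1; apply/eqP => v0; move: v1; rewrite v0 hnorm0 => /eqP.
by rewrite eq_sym oner_eq0.
Qed.

Lemma expN2i_neq0 t : e t != 0.
Proof.
apply/eqP => e0; have /eqP := expN2i_unit t.
by rewrite e0 mul0r eq_sym oner_eq0.
Qed.

Lemma i2_neq0 : 2 * 'i%C != 0 :> R[i].
Proof.
by rewrite mulf_neq0 ?pnatr_eq0// eq_complex/= eqxx oner_eq0.
Qed.

(** Project on the closed range of B + i (resp. B - i): what is left lies in
    the deficiency line, on which T + i (resp. T - i) supplies the vector
    2 i a up (resp. - 2 i b um). *)
Lemma ext_self_adjoint t : self_adjoint (T t).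
Proof.
have Im_i : complex.Im ('i%C : R[i]) != 0 by rewrite /= oner_eq0.
split; [exact: ext_subspace | exact: ext_symmetric | move=> f..].
  have [_ [q Bq ->] fu] := projection_theorem f (range_shift_subspace 'i%C B_linear)
    (range_shift_closed B_linear B_symmetric B_closed Im_i).
  have [c fc] := one_dimensional_span defect_plus up_defect (neq0_unit up_unit) fu.
  pose a := c / (2 * 'i%C).
  exists (q.1 + a *: up + (a * e t) *: um,
    q.2 + (a * 'i%C) *: up - (a * e t * 'i%C) *: um).
    by apply/extensionE; exists a; exists q.
  rewrite /= !scalerDr !scalerA ![_ * 'i%C]mulrC addrACA addNr addr0.
  move/eqP: fc; rewrite subr_eq => /eqP ->.
  rewrite [X in _ = X]addrACA -scalerDl [LHS]addrC [q.2 + _]addrC; congr (_ + _ *: _).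
  by rewrite /a -mulr2n -[RHS]mulr_natl mulrA mulrCA divff ?mulr1// i2_neq0.
have NIm_i : complex.Im (- 'i%C : R[i]) != 0 by rewrite ImN oppr_eq0.
have [_ [q Bq ->] fu] := projection_theorem f (range_shift_subspace (- 'i%C) B_linear)
  (range_shift_closed B_linear B_symmetric B_closed NIm_i).
rewrite -deficiency_minusE in fu.
have [c fc] := one_dimensional_span defect_minus um_defect (neq0_unit um_unit) fu.
pose b := - c / (2 * 'i%C); pose a := b / e t.
have ab : a * e t = b by rewrite divfK ?expN2i_neq0.
exists (q.1 + a *: up + b *: um, q.2 + (a * 'i%C) *: up - (b * 'i%C) *: um).
  by apply/extensionE; exists a; rewrite ab; exists q.
rewrite /= !scaleNr !scalerDr !scalerA ![_ * 'i%C]mulrC.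
move/eqP: fc; rewrite subr_eq => /eqP ->.
rewrite !opprD [RHS]addrACA [X in _ = X + _]addrACA subrr addr0 -opprD -scalerDl.
rewrite -[- (_ *: um)]scaleNr [LHS]addrC; congr (_ + _ *: _).
  by rewrite scaleNr.
rewrite /b -mulr2n -[LHS]opprK; congr (- _).
by rewrite -[RHS]mulr_natl mulrA [RHS]mulrC divfK// i2_neq0.
Qed.

Lemma resolventE (A : set (H * H)) z (v w : H) :
  resolvent A z (v, w) <-> A (w, v + z *: w).
Proof.
split=> [[[x y] Axy /= [-> ->]]|Aw]; first by rewrite subrK.
by exists (w, v + z *: w) => //=; rewrite addrK.
Qed.

(** When r is the resolvent at z applied to up, up + (z - i) r spans the kernel
    of B* - z. *)
Lemma ext_graph_weyl a b z r : ext_graph a b r (up + z *: r) ->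
  ext_graph ((z - 'i%C) * a + 1) ((z - 'i%C) * b)
    (up + (z - 'i%C) *: r) (z *: (up + (z - 'i%C) *: r)).
Proof.
move=> G; have := ext_graph_lin (z - 'i%C) G ext_graph_up.
rewrite addr0 [X in ext_graph _ _ X]addrC; congr ext_graph.
by module_ring.
Qed.

(** Otherwise [up] would be an eigenvector of a symmetric operator for the
    eigenvalue i. *)
Lemma weyl_neq0 t z r : T t (r, up + z *: r) -> up + (z - 'i%C) *: r != 0.
Proof.
move=> Tr; apply/eqP; rewrite addrC => /eqP; rewrite addr_eq0 => /eqP gr.
have Tup : T t (up, 'i%C *: up).
  have := subspaceZ (- (z - 'i%C)) (ext_subspace t) Tr.
  congr (T t); congr pair; first by rewrite /= scaleNr gr opprK.
  rewrite /= scaleNr scalerDr scalerA mulrC -scalerA gr.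
  by module_ring.
have := symmetric_eigenvalue_real (@ext_symmetric t) Tup (neq0_unit up_unit).
by move/eqP; rewrite /= oner_eq0.
Qed.

Local Notation M := (cyclicity_space B up um).

Lemma cyclicity_space_subspace t : subspace (M t).
Proof. exact/closure_subspace/lin_span_subspace. Qed.

Lemma cyclicity_space_closed t : seq_closed (M t).
Proof. by apply: closed_seq_closed; exact: closed_closure. Qed.

Lemma sub_cyclicity_space t z r : complex.Im z != 0 ->
  T t (r, up + z *: r) -> M t r.
Proof.
move=> z0 Tr; apply/subset_closure/sub_lin_span.
by exists z => //; exact/resolventE.
Qed.

(** - z (T - z)^-1 up tends to up as z goes to infinity along the imaginary
    axis: this holds for vectors of the domain, which is dense, and the maps
    z (T - z)^-1 are uniformly bounded there. *)
Lemma up_cyclicity_space t : M t up.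
Proof.
apply/closureP_hnorm => d d0; have d4 : 0 < d / 4 by rewrite divr_gt0.
have [x [[y Bxy]]] : exists x, domain B x /\ hnorm (up - x) < d / 4.
  have dc : 0 < (d / 4)%:C :> R[i] by rewrite ltcR.
  have [|x [xd Bx]] := B_dense (O := ball up (d / 4)%:C) _ (ball_open _ _).
    by exists up; exact: ballxx.
  by exists x; split=> //; move: xd; rewrite -ball_normE/= hnormE ltcR.
(* s is such that |y| / s < d / 4 *)
move=> upx; pose s := 4 * (hnorm y + 1) / d.
have y1 : 0 < hnorm y + 1 by rewrite ltr_wpDl ?hnorm_ge0.
have s0 : 0 < s by rewrite divr_gt0 ?mulr_gt0.
pose z : R[i] := 0 +i* s.
have z0 : complex.Im z != 0 by rewrite gt_eqF.
have [r Tr] := self_adjoint_range up (ext_self_adjoint t) z0.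
exists (- z *: r).
  apply: subspaceZ (lin_span_subspace _) _; apply: sub_lin_span.
  by exists z => //; exact/resolventE.
have TS := ext_subspace t.
have Tp := subspaceB TS (subspaceZ (- z) TS Tr) (sub_ext t Bxy).
have /= := symmetric_shift_ge z (@ext_symmetric t) Tp.
have -> : - z *: (up + z *: r) - y - z *: (- z *: r - x) = - (z *: (up - x) + y).
  by module_ring.
rewrite hnormN (gtr0_norm s0) => /le_trans/(_ (hnorm_triangle _ _)).
rewrite hnormZ.
have -> : modulus z = s.
  by rewrite /modulus normc_def/= expr0n add0r sqrtr_sqr gtr0_norm.
have := hnorm_triangle3 up (- z *: r) x; rewrite (hnormB x) => tri.
have ys : hnorm y < s * (d / 4).
  have -> : s * (d / 4) = hnorm y + 1 by rewrite /s; field; rewrite gt_eqF.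
  by rewrite ltrDl.
set p := hnorm (- z *: r - x) in tri *; set q := hnorm (up - x) in upx tri * => pq.
have : s * p < s * (d / 4 + d / 4) by nra.
rewrite ltr_pM2l// => pd; apply: le_lt_trans tri _; lra.
Qed.

(** Krein's formula: with r the resolvent of T_t at z applied to up and
    g = up + (z - i) r, the same vector for T_t' is r + k g, where k adjusts
    the coordinates on up and um to the boundary condition of T_t'. The
    coefficient of k does not vanish because g, which is not zero, is not an
    eigenvector of T_t'. Hence the cyclicity space does not depend on the
    extension. *)
Lemma resolvent_cyclicity_space t t' z v : complex.Im z != 0 ->
  T t' (v, up + z *: v) -> M t v.
Proof.
move=> z0 Tv; have MS := cyclicity_space_subspace t.
have [r Tr] := self_adjoint_range up (ext_self_adjoint t) z0.
have /extensionE[a G] := Tr; have W := ext_graph_weyl G.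
set c := _ + 1 in W; set c' := _ * (a * _) in W; set g := up + _ in W.
have D0 : c' - c * e t' != 0.
  rewrite subr_eq0; apply/eqP => cc; rewrite cc in W.
  have : T t' (g, z *: g) by apply/extensionE; exists c.
  move=> /(symmetric_eigenvalue_real (@ext_symmetric t')) g0.
  by move/eqP: z0; apply; apply: g0; exact: weyl_neq0 Tr.
pose k := a * (e t' - e t) / (c' - c * e t').
have kD : k * (c' - c * e t') = a * (e t' - e t) by rewrite divfK.
pose w := r + k *: g.
have Tw : T t' (w, up + z *: w).
  apply/extensionE; exists (k * c + a).
  have := ext_graph_lin k W G.
  rewrite [X in ext_graph _ _ X]addrC.
  have -> : (k * c + a) * e t' = k * c' + a * e t.
    apply/eqP; rewrite -subr_eq0; apply/eqP.
    move/eqP: kD; rewrite -subr_eq0 => /eqP kD.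
    by rewrite -[RHS]oppr0 -kD; ring.
  congr ext_graph; rewrite /w; module_ring.
have Td : T t' (v - w, z *: (v - w)).
  have := subspaceB (ext_subspace t') Tv Tw; congr (T t'); congr pair.
  by rewrite /=; module_ring.
have /eqP : v - w = 0.
  apply/eqP; apply: contraNT z0 => vw0.
  by rewrite (symmetric_eigenvalue_real (@ext_symmetric t') Td vw0).
rewrite subr_eq0 => /eqP ->.
have Mr := sub_cyclicity_space z0 Tr.
apply: (subspaceD MS) => //; apply: (subspaceZ _ MS).
by apply: (subspaceD MS); [exact: up_cyclicity_space | exact: (subspaceZ _ MS)].
Qed.

Lemma ext_graph0 : ext_graph 0 0 0 0.
Proof.
by exists (0, 0); [exact: B_linear.1 | rewrite /= !mul0r !scale0r subr0 !addr0].
Qed.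

Lemma ortho_cyclicity_space t v :
  (forall z r, complex.Im z != 0 -> T t (r, up + z *: r) -> dot v r = 0) ->
  forall r, M t r -> dot v r = 0.
Proof.
move=> vr r /closureP_hnorm Mr.
suff h (d : R) : 0 < d -> modulus (dot v r) <= d.
  apply/eqP; rewrite -normr_eq0 modulusE; apply/eqP; congr (_%:C).
  apply/eqP; rewrite eq_le modulus_ge0 andbT.
  by apply/ler_addgt0Pr => d /h; rewrite add0r.
move=> d0; have v1 : 0 < hnorm v + 1 by rewrite ltr_wpDl ?hnorm_ge0.
have [|w [n [c [x [xr ->]]]]] := Mr (d / (hnorm v + 1)); first by rewrite divr_gt0.
set w' := \sum_i _; rewrite ltr_pdivlMr// => rw.
have vw : dot v w' = 0.
  rewrite /w' linear_sumr/= big1// => i _; rewrite dotZr.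
  by have [z z0 /resolventE zr] := xr i; rewrite (vr _ _ z0 zr) mulr0.
have := cauchy_schwarz v (r - w'); rewrite dotBr vw subr0.
have := hnorm_ge0 (r - w'); have := hnorm_ge0 v; nra.
Qed.

(** The eigenvector [v] has a nonzero coordinate a on [up]: otherwise it would
    be an eigenvector of [B], orthogonal to [up] and then to the whole
    cyclicity space. A multiple k v of it is then of the form up + (y - i) g
    with [g] in the domain of T_t', where k is forced by the boundary condition
    of T_t' on [g], and the value of (g, up) follows from the coordinate of [g]
    on [up]. *)
Lemma eigenvector_to_boundary_value t t' t1 v (y : R) : sin (t - t') != 0 ->
  v != 0 -> M t1 v -> T t (v, y%:C *: v) ->
  exists2 g, T t' (g, up + y%:C *: g) &
    y%:C + (1 + y%:C ^+ 2) * dot g up = (cot (t - t'))%:C.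
Proof.
move=> s0 v0 Mv /extensionE[a G].
have yi : y%:C - 'i%C != 0 by rewrite eq_complex/= subr0 sub0r oppr_eq0 oner_eq0 andbF.
have yi' : y%:C + 'i%C != 0 by rewrite eq_complex/= add0r oner_eq0 andbF.
have a0 : a != 0.
  apply: contraNneq v0 => a0; rewrite a0 mul0r in G.
  have vup : dot v up = 0.
    have := ext_graph_coef_up G; rewrite -scalerDl dotZl mulr0 => /eqP.
    by rewrite mulf_eq0 (negbTE yi') => /eqP.
  have Tv : T t1 (v, y%:C *: v) by apply/extensionE; exists 0; rewrite mul0r.
  apply/eqP/dot_eq0/(ortho_cyclicity_space (t := t1)) => // z r z0 Tr.
  have /= := ext_symmetric Tv Tr; rewrite !dotE vup add0r => /eqP.
  rewrite -subr_eq0 -mulrBl mulf_eq0 => /orP[/eqP/(congr1 (@complex.Im R))|/eqP//].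
  rewrite ImD ImN Im_conj/= sub0r opprK => z00.
  by rewrite z00 eqxx in z0.
have i0 : 'i%C != 0 :> R[i] by rewrite eq_complex/= oner_eq0 andbF.
have ci := cot_expN2i s0.
have D0 : e t' - e t != 0.
  apply: contraNneq (expN2i_neq0 t) => D0; move: ci; rewrite D0 mulr0 => /esym/eqP.
  move/eqP: D0; rewrite subr_eq0 => /eqP ->.
  by rewrite mulf_eq0 (negbTE i0)/= -mulr2n mulrn_eq0.
pose k := e t' / (a * (e t' - e t)).
pose g := (y%:C - 'i%C)^-1 *: (k *: v - up).
pose b := e t / ((e t' - e t) * (y%:C - 'i%C)).
have Gg : ext_graph b (b * e t') g (up + y%:C *: g).
  have := ext_graph_lin ((y%:C - 'i%C)^-1 * k) G
    (ext_graph_lin (- (y%:C - 'i%C)^-1) ext_graph_up ext_graph0).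
  congr ext_graph.
  - by rewrite /b /k; field; rewrite yi D0 a0.
  - by rewrite /b /k; field; rewrite yi D0 a0.
  - by rewrite /g; module_ring.
  - by rewrite /g; apply: dot_ext => x; rewrite !dotE; field.
exists g; first by apply/extensionE; exists b.
have := ext_graph_coef_up Gg; rewrite -addrA -scalerDl dotDl dotZl dot_up => h.
apply: (mulIf D0); rewrite ci.
have ii : 'i%C * 'i%C = - 1 :> R[i] by rewrite -expr2 sqr_i.
have -> : y%:C + (1 + y%:C ^+ 2) * dot g up =
    (y%:C - 'i%C) * (1 + (y%:C + 'i%C) * dot g up) + 'i%C + (1 + 'i%C * 'i%C) * dot g up.
  by ring.
rewrite ii subrr mul0r addr0 h /b.
by field; rewrite yi D0.
Qed.

(** The vector up + (y - i) g solves the eigenvalue equation of B* at [y];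
    the value of (g, up) determines its coordinates on [up] and [um], and the
    assumed equality is the boundary condition of T_t. *)
Lemma boundary_value_to_eigenvector t t' g (y : R) : sin (t - t') != 0 ->
  T t' (g, up + y%:C *: g) ->
  y%:C + (1 + y%:C ^+ 2) * dot g up = (cot (t - t'))%:C ->
  T t (up + (y%:C - 'i%C) *: g, y%:C *: (up + (y%:C - 'i%C) *: g)).
Proof.
move=> s0 /extensionE[b Gg] cotE; have := ext_graph_weyl Gg.
set c := _ + 1; set c' := _ * (b * _) => W.
suff cc : c' = c * e t by rewrite cc in W; apply/extensionE; exists c.
have := ext_graph_coef_up Gg; rewrite -addrA -scalerDl dotDl dotZl dot_up => h.
have ii : 'i%C * 'i%C = - 1 :> R[i] by rewrite -expr2 sqr_i.
apply: (mulfI i2_neq0); apply/eqP; rewrite -subr_eq0; apply/eqP.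
have F : (cot (t - t'))%:C = (y%:C - 'i%C) * (2 * 'i%C * b) + 'i%C.
  rewrite -cotE -h.
  have -> : y%:C + (1 + y%:C ^+ 2) * dot g up =
    (y%:C - 'i%C) * (1 + (y%:C + 'i%C) * dot g up) + 'i%C + (1 + 'i%C * 'i%C) * dot g up.
    by ring.
  by rewrite ii subrr mul0r addr0.
have := cot_expN2i s0; rewrite F => /eqP; rewrite -subr_eq0 => /eqP ci.
by rewrite -[RHS]ci /c /c'; ring.
Qed.

End extensions.

(** * Measures with a density, spectral measures *)

Section densities.
Local Open Scope ereal_scope.
Context d (X : measurableType d) (R : realType).
Implicit Types (nu m : {measure set X -> \bar R}) (g : X -> R).

(** A relation between measures rather than an operation, so that it covers
    [weighted_measure] and spectral measures as well as [density] below. *)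
Definition has_density m nu g :=
  forall A, measurable A -> m A = \int[nu]_(x in A) (g x)%:E.

Import HBNNSimple.

Lemma nnsfun_integral_density m nu g (h : {nnsfun X >-> R}) :
  (forall x, 0 <= g x)%R -> measurable_fun setT g -> has_density m nu g ->
  \int[m]_x (h x)%:E = \int[nu]_x ((h x)%:E * (g x)%:E).
Proof.
move=> g0 mg mE; have mg' : measurable_fun setT (EFin \o g) by exact/measurable_EFinP.
rewrite integralT_nnsfun sintegralE.
transitivity (\int[nu]_x \sum_(r \in range h)
    (r%:E * ((EFin \o g) \_ (h @^-1` [set r])) x)); last first.
  apply: eq_integral => x _; rewrite fimfunE -fsumEFin// ge0_mule_fsuml => [|r].
    apply: eq_fsbigr => r _; rewrite EFinM -muleA; congr (_ * _).
    rewrite patchE indicE; case: ifPn => /= hx; rewrite ?mul1e ?mul0e//.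
  exact: nnfun_muleindic_ge0.
have mpatch r : measurable_fun setT ((EFin \o g) \_ (h @^-1` [set r])).
  by apply/(measurable_restrictT _ _).1 => //; exact: measurable_funS mg'.
have patch0 r x : 0 <= ((EFin \o g) \_ (h @^-1` [set r])) x.
  by rewrite patchE; case: ifP => //= _; rewrite lee_fin.
have term0 r x : 0 <= r%:E * ((EFin \o g) \_ (h @^-1` [set r])) x.
  have [r0|r0] := leP 0%R r; first by rewrite mule_ge0// lee_fin.
  by rewrite preimage_nnfun0// patch_set0 mule0.
rewrite ge0_integral_fsum//; last by move=> r; exact: measurable_funeM.
apply: eq_fsbigr => r rh; rewrite ge0_integralZl//; last first.
  by move: rh; rewrite inE => -[y _ <-]; rewrite lee_fin.
by congr (_ * _); rewrite mE// integral_mkcond.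
Qed.

(** Monotone approximation by simple functions. *)
Lemma ge0_integral_density m nu g (f : X -> \bar R) :
  (forall x, 0 <= g x)%R -> measurable_fun setT g -> has_density m nu g ->
  (forall x, 0 <= f x) -> measurable_fun setT f ->
  \int[m]_x f x = \int[nu]_x (f x * (g x)%:E).
Proof.
move=> g0 mg mE f0 mf.
pose h := nnsfun_approx measurableT mf.
have hf x : (h n x)%:E @[n --> \oo] --> f x by exact: cvg_nnsfun_approx.
have mh n : measurable_fun setT (EFin \o h n).
  apply/measurable_EFinP; exact: measurable_funPT.
have hnd x : {homo (fun n => (h n x)%:E) : a b / (a <= b)%N >-> a <= b}.
  by move=> a b ab; rewrite lee_fin; exact/lefP/nd_nnsfun_approx.
have mg' : measurable_fun setT (EFin \o g) by exact/measurable_EFinP.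
have -> : \int[m]_x f x = limn (fun n => \int[m]_x (h n x)%:E).
  rewrite -monotone_convergence//.
  - by apply: eq_integral => x _; exact/esym/cvg_lim.
  - by move=> n x _; rewrite lee_fin.
under eq_fun do rewrite (nnsfun_integral_density _ g0 mg mE).
rewrite -monotone_convergence//.
- apply: eq_integral => x _; apply/cvg_lim => //; apply: cvgeZr => //.
- by move=> n; apply: emeasurable_funM => //; exact: mh.
- by move=> n x _; rewrite mule_ge0// lee_fin.
- by move=> x _ a b ab; rewrite lee_wpmul2r ?lee_fin//; exact: hnd.
Qed.

(** Integrability is not assumed: the positive and negative parts agree
    separately. *)
Lemma integral_density m nu g (f : X -> R) :
  (forall x, 0 <= g x)%R -> measurable_fun setT g -> has_density m nu g ->
  measurable_fun setT f ->
  \int[m]_x (f x)%:E = \int[nu]_x (f x * g x)%:E.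
Proof.
move=> g0 mg mE mf; have mf' : measurable_fun setT (EFin \o f) by exact/measurable_EFinP.
rewrite integralE [RHS]integralE; congr (_ - _).
  rewrite (ge0_integral_density g0 mg mE)//; last exact: measurable_funepos.
  apply: eq_integral => x _; by rewrite !funeposE maxe_pMl ?lee_fin// mul0e.
rewrite (ge0_integral_density g0 mg mE)//; last exact: measurable_funeneg.
apply: eq_integral => x _; rewrite !funenegE maxe_pMl ?lee_fin// mul0e.
by rewrite mulNe.
Qed.

End densities.

Section density_measure.
Local Open Scope ereal_scope.
Context d (X : measurableType d) (R : realType).
Variables (nu : {measure set X -> \bar R}) (g : X -> R).
Hypotheses (g0 : forall x, (0 <= g x)%R) (mg : measurable_fun setT g).

Definition density of (forall x, (0 <= g x)%R) & measurable_fun setT g :=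
  fun A : set X => \int[nu]_(x in A) (g x)%:E.

Let density0 : density g0 mg set0 = 0.
Proof. exact: integral_set0. Qed.

Let density_ge0 A : 0 <= density g0 mg A.
Proof. by apply: integral_ge0 => x _; rewrite lee_fin. Qed.

Let density_sigma_additive : semi_sigma_additive (density g0 mg).
Proof.
apply: semi_sigma_additive_nng_induced; first exact/measurable_EFinP.
by move=> x; rewrite lee_fin.
Qed.

HB.instance Definition _ := isMeasure.Build _ _ _ (density g0 mg)
  density0 density_ge0 density_sigma_additive.

End density_measure.

Section stieltjes.
Context {R : realType} (f : cumulative R R).

Lemma lebesgue_stieltjes_measure_itv (a b : R) : a <= b ->
  lebesgue_stieltjes_measure f `]a, b]%classic = (f b - f a)%:E.
Proof.
move=> ab; rewrite /lebesgue_stieltjes_measure /measure_extension.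
by rewrite measurable_mu_extE/=; [rewrite wlength_itv_bnd | exact: is_ocitv].
Qed.

Lemma lebesgue_stieltjes_measure_eq (mu : {measure set (measurableTypeR R) -> \bar R}) :
  (forall a b, a <= b -> mu `]a, b]%classic = (f b - f a)%:E) ->
  forall A, measurable A -> lebesgue_stieltjes_measure f A = mu A.
Proof.
move=> muE; apply: lebesgue_stieltjes_measure_unique => X /ocitvP[->|].
  by rewrite !measure0.
move=> [[a b]/= ab ->]; rewrite lebesgue_stieltjes_measure_itv ?ltW//.
by rewrite muE// ltW.
Qed.

End stieltjes.

Section spectral_measures.
Context {R : realType} {H : hilbertType R} {M : set H}.
Variable E : spectral_family M.
Implicit Types (v w : H) (a b l k : R).

Local Notation nu := (spectral_measure E).

Lemma spectral_projD k v w : E k (v + w) = E k v + E k w.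
Proof. exact: linearD. Qed.

Lemma spectral_projB k v w : E k (v - w) = E k v - E k w.
Proof. exact: linearB. Qed.

Lemma spectral_projZ k (c : R[i]) v : E k (c *: v) = c *: E k v.
Proof. by rewrite linearZ. Qed.

Lemma spectral_projE l k v : l <= k -> E l (E k v) = E l v.
Proof. by move=> lk; rewrite spectral_proj_min (min_idPl lk). Qed.

Lemma dot_spectral_proj l v w : dot (E l v) (E l w) = dot (E l v) w.
Proof. by rewrite -spectral_proj_sym spectral_proj_min minxx. Qed.

Lemma spectral_distrE v l : spectral_distr E v l = hnorm (E l v) ^+ 2.
Proof. by rewrite /spectral_distr -dot_spectral_proj dot_sqr. Qed.

Lemma spectral_measure_itv v a b : a <= b ->
  nu v `]a, b]%classic = (hnorm (E b v) ^+ 2 - hnorm (E a v) ^+ 2)%:E.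
Proof.
by move=> ab; rewrite -!spectral_distrE; exact: lebesgue_stieltjes_measure_itv.
Qed.

Lemma spectral_measure_eq v (mu : {measure set (measurableTypeR R) -> \bar R}) :
  (forall a b, a <= b ->
     mu `]a, b]%classic = (hnorm (E b v) ^+ 2 - hnorm (E a v) ^+ 2)%:E) ->
  forall A, measurable A -> nu v A = mu A.
Proof.
move=> muE; apply: lebesgue_stieltjes_measure_eq => a b ab.
by rewrite muE// -!spectral_distrE.
Qed.

Lemma hnorm_spectral_projB v a : hnorm (v - E a v) ^+ 2 =
  hnorm v ^+ 2 - hnorm (E a v) ^+ 2.
Proof.
rewrite hnorm_sqrB Re_dotC -dot_spectral_proj -hnorm_sqr.
by ring.
Qed.

(** The mass of ]-n, n] is |E(n) v|^2 - |E(- n) v|^2. *)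
Lemma spectral_measure_setT v : M v -> nu v setT = (hnorm v ^+ 2)%:E.
Proof.
move=> Mv; rewrite -(bigcup_itvT false false).
pose I n : set R := `]- (n%:R), n%:R]%classic.
have nuI : (nu v \o I) @ \oo --> nu v (\bigcup_n I n).
  apply: nondecreasing_cvg_mu; rewrite /I//; first exact: bigcup_measurable.
  by move=> *; apply/subsetPset/subset_itv; rewrite leBSide/= ?lerN2 ler_nat.
have nuE : nu v \o I = (fun n => (hnorm (E n%:R v) ^+ 2 - hnorm (E (- n%:R) v) ^+ 2)%:E).
  by apply/funext => n; rewrite /= spectral_measure_itv// ge0_cp.
rewrite nuE in nuI; apply/esym; apply: cvg_unique nuI => //.
apply/cvg_EFin; first by near=> F.
apply/(@cvgrPdist_lt _ R^o) => e e0; rewrite /=.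
have c0 : 0 < Num.sqrt (e / 2) by rewrite sqrtr_gt0 divr_gt0.
have c0' : 0 < (Num.sqrt (e / 2))%:C :> R[i] by rewrite ltcR.
have /cvgrPdist_lt/(_ _ c0')[a [_ aP]] := @spectral_proj_pinfty _ _ _ E v Mv.
have /cvgrPdist_lt/(_ _ c0')[b [_ bP]] := @spectral_proj_ninfty _ _ _ E v.
near=> n; have an : a < n%:R by near: n; exact: nbhs_infty_gtr.
have bn : - n%:R < b by rewrite ltrNl; near: n; exact: nbhs_infty_gtr.
have lt_sqr x : 0 <= x -> x < Num.sqrt (e / 2) -> x ^+ 2 < e / 2.
  move=> x0 xe; rewrite -[X in _ < X]sqr_sqrtr ?divr_ge0 ?ltW//.
  by rewrite ltr_pXn2r// nnegrE sqrtr_ge0.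
have := aP _ an; have := bP _ bn; rewrite sub0r hnormE hnormN hnormE !ltcR.
move=> /(lt_sqr _ (hnorm_ge0 _)) + /(lt_sqr _ (hnorm_ge0 _)).
rewrite hnorm_spectral_projB => h1 h2.
rewrite opprB addrA addrAC ger0_norm.
  lra.
by rewrite addr_ge0 ?sqr_ge0// -hnorm_spectral_projB sqr_ge0.
Unshelve. all: by end_near.
Qed.

End spectral_measures.

(** * Spectral projections of bounded intervals *)

Section interval_projections.
Context {R : realType} {H : hilbertType R} {M : set H}.
Variable E : spectral_family M.
Hypothesis M_subspace : subspace M.
Implicit Types (v w : H) (a b l k j : R).

Local Notation nu := (spectral_measure E).

(** The spectral projection of the half-open interval ]l, k]. *)
Definition itv_proj l k v := E k v - E l v.

Local Notation P := itv_proj.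

Lemma itv_projD l k v w : P l k (v + w) = P l k v + P l k w.
Proof. by rewrite /itv_proj !spectral_projD opprD addrACA. Qed.

Lemma itv_projZ l k (c : R[i]) v : P l k (c *: v) = c *: P l k v.
Proof. by rewrite /itv_proj !spectral_projZ scalerBr. Qed.

Lemma itv_projB l k v w : P l k (v - w) = P l k v - P l k w.
Proof. by rewrite -scaleN1r itv_projD itv_projZ scaleN1r. Qed.

Lemma itv_proj_mem l k v : M (P l k v).
Proof. by apply: subspaceB M_subspace _ _; exact: spectral_proj_range. Qed.

Lemma itv_proj_sym l k v w : dot (P l k v) w = dot v (P l k w).
Proof. by rewrite /itv_proj !dotE !spectral_proj_sym. Qed.

Lemma spectral_proj_itv_proj j l k v :
  E j (P l k v) = P (minr j l) (minr j k) v.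
Proof. by rewrite /itv_proj spectral_projB !spectral_proj_min. Qed.

Lemma itv_proj_comm j l k v : P l k (E j v) = E j (P l k v).
Proof. by rewrite /itv_proj spectral_projB !spectral_proj_min ![minr j _]minC. Qed.

Lemma itv_proj_idem l k v : l <= k -> P l k (P l k v) = P l k v.
Proof.
move=> lk; rewrite {1}/itv_proj !spectral_proj_itv_proj !minxx.
by rewrite (min_idPl lk) (min_idPr lk) /itv_proj subrr subr0.
Qed.

Lemma hnorm_itv_proj l k v : l <= k ->
  hnorm (P l k v) ^+ 2 = hnorm (E k v) ^+ 2 - hnorm (E l v) ^+ 2.
Proof.
move=> lk; have := hnorm_spectral_projB E (E k v) l.
by rewrite spectral_projE.
Qed.

Lemma spectral_measure_oc l k v : l <= k ->
  nu v `]l, k]%classic = (hnorm (P l k v) ^+ 2)%:E.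
Proof. by move=> lk; rewrite hnorm_itv_proj// spectral_measure_itv. Qed.

Lemma dot_itv_proj_compl l k j v w : l <= k ->
  dot (E j (P l k v)) (w - P l k w) = 0.
Proof.
move=> lk; rewrite dotBr -itv_proj_sym itv_proj_comm itv_proj_idem//.
by rewrite subrr.
Qed.

Lemma dot_compl_itv_proj l k j v w : l <= k ->
  dot (E j (v - P l k v)) (P l k w) = 0.
Proof.
move=> lk; rewrite -itv_proj_sym itv_proj_comm itv_projB itv_proj_idem//.
by rewrite subrr linear0 dot0l.
Qed.

Lemma spectral_measure_itv_proj l k v (A : set (measurableTypeR R)) :
  l <= k -> measurable A ->
  nu (P l k v) A = nu v (A `&` `]l, k]%classic).
Proof.
move=> lk mA; have mJ : measurable (`]l, k]%classic : set (measurableTypeR R)).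
  exact: measurable_itv.
rewrite (@spectral_measure_eq _ _ _ _ _ (mrestr (nu v) mJ))// => a b ab.
rewrite !spectral_proj_itv_proj !hnorm_itv_proj ?le_min2 ?lexx//.
rewrite /= /mrestr (_ : _ `&` _ = `]maxr a l, minr b k]%classic); last first.
  apply/seteqP; split=> x /=; rewrite !in_itv/= gt_max le_min.
    by move=> [/andP[-> ->] /andP[-> ->]].
  by move=> /andP[/andP[-> ->] /andP[-> ->]].
have [h|h] := leP (maxr a l) (minr b k); last first.
  rewrite set_itv_ge ?bnd_simp -?leNgt ?ltW// measure0; congr (_%:E).
  by move: h ab lk; case: (leP b k); case: (ltP b l); case: (leP a k);
    case: (leP a l); lra.
rewrite spectral_measure_itv//; congr (_%:E).
by move: h ab lk; case: (leP b k); case: (ltP b l); case: (leP a k);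
  case: (leP a l); lra.
Qed.

Lemma integral_itv_proj l k v (f : measurableTypeR R -> R) : l <= k ->
  measurable_fun setT f ->
  (\int[nu (P l k v)]_x (f x)%:E = \int[nu v]_(x in `]l, k]) (f x)%:E)%E.
Proof.
move=> lk mf.
have mJ : measurable (`]l, k]%classic : set (measurableTypeR R)).
  exact: measurable_itv.
rewrite (@integral_density _ _ _ (nu (P l k v)) (nu v) (\1_`]l, k]))//.
  rewrite [RHS]integral_mkcond; apply: eq_integral => x _.
  rewrite patchE indicE; case: ifPn => /= _; rewrite ?mulr1 ?mulr0//.
move=> A mA; rewrite spectral_measure_itv_proj// integral_indic// setIC//.
Qed.

End interval_projections.

(** * Spectral measure of an image vector *)

Section spectral_operator.
Context {R : realType} {H : hilbertType R} {M : set H}.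
Variables (A : set (H * H)) (E : spectral_family M).
Hypotheses (M_subspace : subspace M) (A_subspace : subspace A).
Hypothesis A_symmetric : symmetric_operator A.
Hypothesis A_spectral : is_spectral_family_of A E.
Implicit Types (u v w p q : H) (a b l k j : R) (z : R[i]).

Local Notation nu := (spectral_measure E).
Local Notation P := (itv_proj E).
Local Notation mR := (measurableTypeR R).

Lemma measurable_sqr_mR : measurable_fun [set: mR] (fun x : mR => (x : R) ^+ 2).
Proof. exact: measurable_funX. Qed.

Lemma dom_operatorP v : (exists w, A (v, w)) <->
  M v /\ (\int[nu v]_x (x ^+ 2)%:E < +oo)%E.
Proof. by rewrite -[X in X <-> _]/(domain A v) A_spectral.1. Qed.

Lemma dom_operator_mem v w : A (v, w) -> M v.
Proof. by move=> Avw; have /dom_operatorP[] : exists w, A (v, w) by exists w. Qed.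

Lemma dot_operator v w : A (v, w) -> dot w v = (\int[nu v]_x x)%R%:C.
Proof. exact: A_spectral.2. Qed.

Lemma spectral_measure_lty v : M v -> (nu v setT < +oo)%E.
Proof. by move=> Mv; rewrite spectral_measure_setT// ltry. Qed.

(** On a bounded interval x^2 is bounded, hence integrable. *)
Lemma dom_itv_proj l k v : l <= k -> M v -> exists w, A (P l k v, w).
Proof.
move=> lk Mv; apply/dom_operatorP; split; first exact: itv_proj_mem.
rewrite integral_itv_proj//.
apply: (@le_lt_trans _ _ (\int[nu v]_(x in `]l, k]) (cst (l ^+ 2 + k ^+ 2)%:E) x)%E).
  apply: ge0_le_integral => //.
  - by move=> x _; rewrite lee_fin sqr_ge0.
  - by apply/measurable_EFinP; apply: measurable_funTS; exact: measurable_sqr_mR.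
  - move=> x /=; rewrite in_itv/= lee_fin => /andP[lx xk]; 
    have [x0|x0] := leP 0 x; nra.
rewrite integral_cst//= spectral_measure_oc// -EFinM ltry//.
Qed.

Lemma integrable_quadratic v w (f : mR -> R) (c : R) : A (v, w) ->
  measurable_fun setT f -> (forall x, `|f x| <= c * (1 + x ^+ 2)) ->
  (nu v).-integrable setT (EFin \o f).
Proof.
move=> Avw mf fc.
have /dom_operatorP[Mv x2] : exists w, A (v, w) by exists w.
have m2 := measurable_sqr_mR.
apply: (@le_integrable _ _ _ _ _ measurableT (EFin \o f)
  (fun x => c%:E * (cst (1%R)%:E \+ (fun x : mR => (x ^+ 2)%:E)) x)%E).
- exact/measurable_EFinP.
- move=> x _ /=; rewrite lee_fin (le_trans (fc x))//.
  exact: ler_norm.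
apply: integrableZl => //; apply: integrableD => //.
  apply/integrableP; split; first exact: measurable_cst.
  under eq_integral do rewrite /= normr1.
  by rewrite integral_cst// mul1e spectral_measure_lty.
apply/integrableP; split; first exact/measurable_EFinP.
by under eq_integral do rewrite /= ger0_norm ?sqr_ge0//.
Qed.

Lemma integrable_id v w : A (v, w) ->
  (nu v).-integrable setT (EFin \o (fun x : mR => x : R)).
Proof.
move=> Avw; apply: (integrable_quadratic (c := 1) Avw) => // x.
by rewrite mul1r ler_norml; apply/andP; split; nra.
Qed.

Lemma integrable_sqr v w : A (v, w) ->
  (nu v).-integrable setT (EFin \o (fun x : mR => (x : R) ^+ 2)).
Proof.
move=> Avw; apply: (integrable_quadratic (c := 1) Avw) => [|x].
  exact: measurable_sqr_mR.
by rewrite mul1r ger0_norm ?sqr_ge0// lerDr.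
Qed.

Lemma spectral_measureD p q (X : set mR) : measurable X ->
  (forall j, dot (E j p) q = 0) ->
  nu (p + q) X = measure_add (nu p) (nu q) X.
Proof.
move=> mX pq; apply: spectral_measure_eq => // a b ab.
rewrite [LHS]measure_addE; have /= -> := spectral_measure_itv E p ab.
have /= -> := spectral_measure_itv E q ab.
rewrite -EFinD; congr (_%:E); rewrite !spectral_projD.
by rewrite !hnorm_sqrD !dot_spectral_proj !pq/= mulr0 !addr0; ring.
Qed.

(** The quadratic form (A p, p), which is the integral of x against the
    spectral measure of p, is additive on vectors with E-orthogonal components;
    applied to p, q and to i p, q this kills the real and the imaginary part of
    the cross term. *)
Lemma dot_operator_orthogonal p p' q q' : A (p, p') -> A (q, q') ->
  (forall j, dot (E j p) q = 0) -> dot p' q = 0.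
Proof.
have Re0 v v' w w' : A (v, v') -> A (w, w') ->
    (forall j, dot (E j v) w = 0) -> complex.Re (dot v' w) = 0.
  move=> Av Aw vw.
  have Avw : A (v + w, v' + w') := subspaceD A_subspace Av Aw.
  have iv := integrable_id Av; have iw := integrable_id Aw.
  have : (\int[nu (v + w)]_x x = \int[nu v]_x x + \int[nu w]_x x)%R.
    rewrite /Rintegral (@eq_measure_integral _ _ _ _ (measure_add (nu v) (nu w))).
      rewrite integral_measure_add// fineD//; exact: integrable_fin_num.
    by move=> X mX _; exact: spectral_measureD.
  have ReE x x' (Ax : A (x, x')) : (\int[nu x]_x x)%R = complex.Re (dot x' x).
    by rewrite (dot_operator Ax).
  rewrite (ReE _ _ Avw) (ReE _ _ Av) (ReE _ _ Aw).
  have sym : complex.Re (dot w' v) = complex.Re (dot v' w).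
    by rewrite (A_symmetric Aw Av : dot w' v = dot w v') Re_dotC.
  rewrite dotDr !dotDl !ReD sym.
  move: (complex.Re (dot v' v)) (complex.Re (dot w' w)) (complex.Re (dot v' w)).
  by move=> a b c; lra.
move=> Ap Aq pq; apply: complex_ext; first exact: Re0 Ap Aq pq.
have := Re0 _ _ _ _ (subspaceZ 'i%C A_subspace Ap) Aq.
rewrite dotZl ReM/= mul0r mul1r sub0r => h.
apply/eqP; rewrite -oppr_eq0 h// => j.
by rewrite spectral_projZ dotZl pq mulr0.
Qed.

(** In weak form, the compression of [A] by the projection of ]l, k] maps
    [P l k v] to [P l k v']. It is stated for pairings with the domain only, as
    [A] is not known to map into [M]. *)
Lemma dot_operator_itv_proj v v' p' q q' l k : l <= k ->
  A (v, v') -> A (P l k v, p') -> A (q, q') -> dot p' q = dot (P l k v') q.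
Proof.
move=> lk Av Ap Aq.
have [r Ar] := dom_itv_proj lk (dom_operator_mem Aq).
have h1 : dot p' (q - P l k q) = 0.
  apply: dot_operator_orthogonal Ap (subspaceB A_subspace Aq Ar) _ => j.
  exact: dot_itv_proj_compl.
have h2 : dot (v' - p') (P l k q) = 0.
  apply: dot_operator_orthogonal (subspaceB A_subspace Av Ap) Ar _ => j.
  exact: dot_compl_itv_proj.
rewrite itv_proj_sym; apply/eqP; move/eqP: h1; rewrite dotBr subr_eq0 => /eqP ->.
by move/eqP: h2; rewrite dotBl subr_eq0 eq_sym.
Qed.

Lemma measurable_shift_mR l : measurable_fun [set: mR] (fun x : mR => (x : R) - l).
Proof. exact: measurable_funB. Qed.

Lemma integrable_shift v v' l : A (v, v') ->
  (nu v).-integrable setT (EFin \o (fun x : mR => (x : R) - l)).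
Proof.
move=> Av; apply: (integrable_quadratic (c := 1 + `|l|) Av) => [|x].
  exact: measurable_shift_mR.
rewrite (le_trans (ler_normB _ _))//.
have := normr_ge0 l; have : `|x| <= 1 + x ^+ 2; last by nra.
by rewrite ler_norml; apply/andP; split; nra.
Qed.

Lemma integrable_shift_sqr v v' l (X : set mR) : A (v, v') -> measurable X ->
  (nu v).-integrable X (EFin \o (fun x : mR => ((x : R) - l) ^+ 2)).
Proof.
move=> Av mX; apply: (@integrableS _ _ _ _ setT) => //.
apply: (integrable_quadratic (c := 2 * (1 + l ^+ 2)) Av) => [|x].
  by apply: measurable_funX; exact: measurable_shift_mR.
rewrite ger0_norm ?sqr_ge0//; have := sqr_ge0 (x + l).
have := sqr_ge0 x; have := sqr_ge0 l; have := mulr_ge0 (sqr_ge0 x) (sqr_ge0 l).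
rewrite sqrrB sqrrD; nra.
Qed.

Lemma dot_operator_shift v v' l : A (v, v') ->
  complex.Re (dot (v' - l%:C *: v) v) = (\int[nu v]_x (x - l))%R.
Proof.
move=> Av; have Mv := dom_operator_mem Av.
rewrite RintegralB//; first 1 last.
- exact: integrable_id Av.
- apply/integrableP; split; first exact: measurable_cst.
  by rewrite integral_cst//= lte_mul_pinfty// spectral_measure_lty.
rewrite Rintegral_cst//= spectral_measure_setT//= !dotE ReD ReN (dot_operator Av).
by rewrite dot_sqr ReM/= mul0r subr0.
Qed.

(** The two projections commute; exchanging them gives an integral over ]a, b]
    for which the other interval survives as a density. *)
Lemma integral_itv_proj2 l k a b v (f : mR -> R) : l <= k -> a <= b ->
  measurable_fun setT f ->
  (\int[nu (P a b (P l k v))]_x (f x)%:E =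
   \int[nu v]_(x in `]a, b]) (f x * \1_`]l, k] x)%:E)%E.
Proof.
move=> lk ab mf.
have mJ : measurable (`]l, k]%classic : set mR) by exact: measurable_itv.
have -> : P a b (P l k v) = P l k (P a b v).
  by rewrite {2 4}/itv_proj itv_projB !itv_proj_comm.
have mfJ : measurable_fun setT (fun x : mR => f x * \1_`]l, k] x).
  exact: measurable_funM.
apply: etrans (integral_itv_proj _ _ lk mf) _.
apply: etrans _ (integral_itv_proj _ _ ab mfJ).
rewrite integral_mkcond; apply: eq_integral => x _.
by rewrite patchE indicE; case: ifPn => /= _; rewrite ?mulr1 ?mulr0.
Qed.

Lemma hnorm_sqrDB (x y : H) :
  hnorm (x + y) ^+ 2 - hnorm (x - y) ^+ 2 = 4 * complex.Re (dot x y).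
Proof. by rewrite hnorm_sqrD hnorm_sqrB; ring. Qed.

Lemma polar_shift (x x' y y' : H) l : dot y' x = dot y x' ->
  complex.Re (dot (x' + y' - l%:C *: (x + y)) (x + y)) -
  complex.Re (dot (x' - y' - l%:C *: (x - y)) (x - y)) =
  4 * complex.Re (dot (x' - l%:C *: x) y).
Proof.
move=> yx; rewrite !dotE yx !(ReD, ReN, ReM)/= (Re_dotC y x') (Re_dotC y x).
by ring.
Qed.

Section image.
Variables (v v' : H) (l k : R).
Hypotheses (Av : A (v, v')) (Mv' : M v') (lk : l <= k).

Let p := P l k v.
Let w := P l k v' - l%:C *: p.
Let weight (x : mR) : R := 4 * ((x - l) * \1_`]l, k] x).

Let weight_ge0 x : 0 <= weight x.
Proof.
rewrite /weight mulr_ge0// indicE; case: (boolP (x \in _)) => /=; last first.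
  by rewrite mulr0.
by rewrite inE/= in_itv/= mulr1 subr_ge0 => /andP[/ltW].
Qed.

Let measurable_weight : measurable_fun setT weight.
Proof.
apply: measurable_funM => //; apply: measurable_funM => //.
  exact: measurable_shift_mR.
Qed.

(** Polarization of the spectral measures: with w the image of p under A - l,
    the measures of p + w and p - w differ by four times the measure of
    (x - l) against the spectral measure of p. Starting from the left end l of
    the interval makes this difference a positive measure. *)
Lemma itv_proj_polarization (X : set mR) : measurable X ->
  nu (p + w) X =
  measure_add (nu (p - w)) (density (nu v) weight_ge0 measurable_weight) X.
Proof.
move=> mX; apply: spectral_measure_eq => // a b ab.
rewrite [LHS]measure_addE; have /= -> := spectral_measure_oc E (p - w) ab.
rewrite -hnorm_itv_proj//.
have [p' Ap] := dom_itv_proj lk (dom_operator_mem Av).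
have [q' Aq] := dom_itv_proj ab (dom_operator_mem Ap).
rewrite /density; under eq_integral do rewrite EFinM.
rewrite ge0_integralZl//; last 2 first.
- apply/measurable_EFinP/(measurable_funS measurableT) => //.
  by apply: measurable_funM; first exact: measurable_shift_mR.
- by move=> x _; have := weight_ge0 x; rewrite /weight pmulr_rge0.
rewrite -integral_itv_proj2//; last exact: measurable_shift_mR.
rewrite -[(\int[_]_x _)%E]fineK; last exact: integrable_fin_num (integrable_shift l Aq).
have := dot_operator_shift l Aq; rewrite /Rintegral => <-.
rewrite -EFinM -EFinD; congr (_%:E).
have -> : P a b (p + w) = P a b p + P a b w by exact: itv_projD.
have -> : P a b (p - w) = P a b p - P a b w by exact: itv_projB.
apply/eqP.
rewrite eq_sym [X in _ == X]addrC -subr_eq hnorm_sqrDB; apply/eqP/esym.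
congr (_ * _); rewrite -[dot (P a b p) _]itv_proj_sym itv_proj_idem// [RHS]Re_dotC.
congr complex.Re; rewrite /w (dotBl (P l k v')) (dotBl q') !dotZl.
rewrite -(dot_operator_itv_proj lk Av Ap Aq : _ = dot (P l k v') (P a b p)).
rewrite (dot_operator_itv_proj ab Ap Aq Aq : dot q' (P a b p) = _).
by rewrite -/p [dot (P a b p') _]itv_proj_sym [dot (P a b p) _]itv_proj_sym itv_proj_idem.
Qed.

(** Integrating x - l against both sides of [itv_proj_polarization] turns the
    quadratic form of A - l at p + w and p - w into 4 |w|^2. *)
Lemma hnorm_itv_proj_image :
  hnorm w ^+ 2 = (\int[nu v]_(x in `]l, k]) ((x - l) ^+ 2))%R.
Proof.
have [p' Ap] := dom_itv_proj lk (dom_operator_mem Av).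
have [v2 Av2] := dom_itv_proj lk Mv'.
have [w' Aw] : exists w', A (w, w').
  exists (v2 - l%:C *: p').
  exact: subspaceB A_subspace Av2 (subspaceZ _ A_subspace Ap).
have Ap_plus : A (p + w, p' + w') := subspaceD A_subspace Ap Aw.
have Ap_minus : A (p - w, p' - w') := subspaceB A_subspace Ap Aw.
set D := density (nu v) weight_ge0 measurable_weight.
have int_plus := integrable_shift l Ap_plus.
have int_minus := integrable_shift l Ap_minus.
have mshift := measurable_shift_mR l.
have int_D : D.-integrable setT (EFin \o (fun x : mR => (x : R) - l)).
  apply/integrableP; split; first exact/measurable_EFinP.
  have /integrableP[_] := int_plus.
  rewrite (@eq_measure_integral _ _ _ _ (measure_add (nu (p - w)) D)); last first.
    by move=> X mX _; exact: itv_proj_polarization.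
  rewrite ge0_integral_measure_add//; last first.
    by apply/measurable_EFinP/measurableT_comp.
  apply: le_lt_trans; rewrite leeDr// integral_ge0//.
have shiftE : (\int[nu (p + w)]_x (x - l) = \int[nu (p - w)]_x (x - l) +
    4 * \int[nu v]_(x in `]l, k]) ((x - l) ^+ 2))%R.
  rewrite /Rintegral (@eq_measure_integral _ _ _ _ (measure_add (nu (p - w)) D)); last first.
    by move=> X mX _; exact: itv_proj_polarization.
  rewrite integral_measure_add//.
  rewrite fineD; [|exact: integrable_fin_num int_minus|exact: integrable_fin_num int_D].
  congr (_ + _).
  rewrite (@integral_density _ _ _ D (nu v) weight)//.
  rewrite [X in _ = _ * fine X]integral_mkcond.
  transitivity (\int[nu v]_x (4 * (((fun x : mR => (x - l) ^+ 2) \_ `]l, k]) x)))%R.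
    apply: eq_Rintegral => x _; rewrite /weight patchE indicE.
    by case: ifPn => _ /=; rewrite ?mulr0// mulr1 mulrCA expr2.
  have isqr : (nu v).-integrable `]l, k] (EFin \o (fun x : mR => ((x : R) - l) ^+ 2)).
    by apply: integrable_shift_sqr Av _; exact: measurable_itv.
  rewrite RintegralZl//; first by rewrite /Rintegral restrict_EFin.
  by move: isqr => /integrable_mkcond; rewrite restrict_EFin; exact.
have := polar_shift l (A_symmetric Aw Ap).
rewrite (dot_operator_shift l Ap_plus) (dot_operator_shift l Ap_minus) shiftE.
have n4 : (4 : R) != 0 by rewrite pnatr_eq0.
rewrite addrAC subrr add0r => /(mulfI n4) ->.
rewrite hnorm_sqr [in LHS]/w (dotBl (P l k v')) (dotBl p') !dotZl.
by rewrite (dot_operator_itv_proj lk Av Ap Aw).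
Qed.

End image.

(** The squared modulus of x - z, for real x. *)
Definition sqr_dist z (x : mR) : R := (x - complex.Re z) ^+ 2 + complex.Im z ^+ 2.

Lemma sqr_dist_ge0 z x : 0 <= sqr_dist z x.
Proof. by rewrite addr_ge0 ?sqr_ge0. Qed.

Lemma measurable_sqr_dist z : measurable_fun setT (sqr_dist z).
Proof.
by apply: measurable_funD => //; apply: measurable_funX; exact: measurable_shift_mR.
Qed.

(** On ]a, b] the projection of v' - z v is w + (a - z) p, with p the
    projection of v and w the image of p under A - a; expanding its squared
    norm gives the integral of |x - z|^2 over the interval. *)
Lemma spectral_measure_image v v' z : A (v, v') -> M v' ->
  has_density (nu (v' - z *: v)) (nu v) (sqr_dist z).
Proof.
move=> Av Mv' X mX.
rewrite (@spectral_measure_eq _ _ _ _ _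
  (density (nu v) (sqr_dist_ge0 z) (measurable_sqr_dist z)))// => a b ab.
rewrite -hnorm_itv_proj// /density/=.
have [p' Ap] := dom_itv_proj ab (dom_operator_mem Av).
have mJ : measurable (`]a, b]%classic : set mR) by exact: measurable_itv.
have i2 := integrable_shift_sqr a Av mJ.
have i1 : (nu v).-integrable `]a, b] (EFin \o (fun x : mR => (x : R) - a)).
  by apply: integrableS (integrable_shift a Av).
have i0 c : (nu v).-integrable `]a, b] (EFin \o (fun x : mR => c : R)).
  apply: (@integrableS _ _ _ _ setT) => //.
  apply/integrableP; split; first exact: measurable_cst.
  rewrite integral_cst//= lte_mul_pinfty// spectral_measure_lty//.
  exact: dom_operator_mem Av.
set s := complex.Re z; set t := complex.Im z.
have gE : sqr_dist z = (fun x : mR =>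
    (x - a) ^+ 2 + (2 * (a - s) * (x - a) + ((a - s) ^+ 2 + t ^+ 2))).
  by apply/funext => x; rewrite /sqr_dist -/s -/t; ring.
have i1' : (nu v).-integrable `]a, b]
    (EFin \o (fun x : mR => 2 * (a - s) * ((x : R) - a))).
  exact: (integrableZl mJ (2 * (a - s)) i1).
have i10 : (nu v).-integrable `]a, b]
    (EFin \o (fun x : mR => 2 * (a - s) * ((x : R) - a) + ((a - s) ^+ 2 + t ^+ 2))).
  exact: (integrableD mJ i1' (i0 _)).
have ig : (nu v).-integrable `]a, b] (EFin \o sqr_dist z).
  by rewrite gE; exact: (integrableD mJ i2 i10).
rewrite -[LHS]fineK; last exact: integrable_fin_num ig.
congr (_%:E); rewrite -/(Rintegral _ _ _) gE.
rewrite RintegralD// RintegralD// RintegralZl// Rintegral_cst//.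
rewrite -(hnorm_itv_proj_image Av Mv' ab).
rewrite [nu v _](spectral_measure_oc E v ab) /=.
have <- : complex.Re (dot (P a b v' - a%:C *: P a b v) (P a b v)) =
    (\int[nu v]_(x in `]a, b]) (x - a))%R.
  rewrite (dotBl (P a b v')) -(dot_operator_itv_proj ab Av Ap Ap) -dotBl.
  rewrite (dot_operator_shift a Ap) /Rintegral integral_itv_proj//.
  exact: measurable_shift_mR.
set p := P a b v; set w := P a b v' - _.
have -> : P a b (v' - z *: v) = w + (a%:C - z) *: p.
  have -> : P a b (v' - z *: v) = P a b v' - z *: p.
    by rewrite -itv_projZ; exact: itv_projB.
  by rewrite scalerBl addrA subrK.
have Im0 : complex.Im (dot w p) = 0.
  rewrite /w (dotBl (P a b v')) -(dot_operator_itv_proj ab Av Ap Ap).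
  by rewrite (dot_operator Ap) dotZl dot_sqr/= mulr0 mul0r addr0 subrr.
rewrite [RHS]hnorm_sqrD hnormZ exprMn modulus_sqr dotZr ReM Re_conj Im0 mulr0 subr0.
rewrite !(ReD, ReN, ImD, ImN)/= sub0r sqrrN -/s -/t.
by ring.
Qed.

End spectral_operator.

(** * The Borel transform as a matrix element of the resolvent *)

Section inverse_square_distance.
Context {R : realType}.
Implicit Types (x y : R) (z : R[i]).
Local Notation mR := (measurableTypeR R).

Lemma sqr_dist_gt0 z (x : mR) : complex.Im z != 0 -> 0 < sqr_dist z x.
Proof.
move=> z0; rewrite /sqr_dist ltr_wpDl ?sqr_ge0// lt_def sqr_ge0 andbT.
by rewrite sqrf_eq0.
Qed.

Lemma measurable_sqr_distV z : complex.Im z != 0 ->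
  measurable_fun setT (fun x : mR => (sqr_dist z x)^-1).
Proof.
move=> z0; apply: continuous_measurable_fun => x.
apply: cvgV; first by rewrite gt_eqF// sqr_dist_gt0.
apply: cvgD; last exact: cvg_cst.
have -> : (fun x0 : R => (x0 - complex.Re z) ^+ 2) =
    (fun x0 => (x0 - complex.Re z) * (x0 - complex.Re z)) by [].
by rewrite expr2; apply: cvgM; apply: cvgB => //; exact: cvg_cst.
Qed.

Definition approach y (n : nat) : R[i] := y +i* n.+1%:R^-1.

Lemma Im_approach_gt0 y n : 0 < complex.Im (approach y n).
Proof. by rewrite /= invr_gt0. Qed.

Lemma Im_approach_neq0 y n : complex.Im (approach y n) != 0.
Proof. by rewrite gt_eqF ?Im_approach_gt0. Qed.

Lemma sqr_distV_cvg y (x : mR) :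
  ((sqr_dist (approach y n) x)^-1)%:E @[n --> \oo] --> inv_sqr_dist y x.
Proof.
rewrite /inv_sqr_dist; case: eqVneq => [->|xy].
  apply/cvgeyPge => C; near=> n.
  rewrite /sqr_dist/= subrr expr0n add0r lee_fin -exprVn invrK.
  have Cn : C <= n%:R by near: n; exact: nbhs_infty_ger.
  have n0 : 0 <= n%:R :> R by [].
  rewrite -natr1; nra.
apply/cvg_EFin; first by near=> n.
apply: cvgV; first by rewrite sqrf_eq0 subr_eq0.
have h : (x - y) ^+ 2 + n.+1%:R^-1 * n.+1%:R^-1 @[n --> \oo] -->
    (x - y) ^+ 2 + 0 * 0.
  apply: (@cvgD _ R^o); first exact: cvg_cst.
  exact: (cvgM (@cvg_harmonic R) (@cvg_harmonic R)).
by move: h; rewrite mulr0 addr0.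
Unshelve. all: by end_near.
Qed.

Lemma sqr_distV_nondecreasing y (x : mR) :
  {homo (fun n => ((sqr_dist (approach y n) x)^-1)%:E) : m n / (m <= n)%N >-> (m <= n)%E}.
Proof.
have sd0 k : 0 < sqr_dist (approach y k) x.
  by rewrite sqr_dist_gt0 ?Im_approach_neq0.
move=> m n mn; rewrite lee_fin lef_pV2 ?posrE//.
have Im0 k := ltW (Im_approach_gt0 y k).
rewrite lerD2l ler_pXn2r// ?nnegrE//=.
by rewrite lef_pV2 ?posrE// ler_nat.
Qed.

(** Monotone convergence, with value +oo in the limit at x = y. *)
Lemma integral_inv_sqr_dist (mu : {measure set mR -> \bar R}) y :
  (\int[mu]_x ((sqr_dist (approach y n) x)^-1)%:E @[n --> \oo]
     --> \int[mu]_x inv_sqr_dist y x)%E.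
Proof.
have -> : (\int[mu]_x inv_sqr_dist y x =
    \int[mu]_x limn (fun n => ((sqr_dist (approach y n) x)^-1)%:E))%E.
  by apply: eq_integral => x _; apply/esym/cvg_lim => //; exact: sqr_distV_cvg.
apply: cvg_monotone_convergence => //.
- move=> n; apply/measurable_EFinP; apply: measurable_sqr_distV.
  exact: Im_approach_neq0.
- by move=> n x _; rewrite lee_fin invr_ge0 sqr_dist_ge0.
- by move=> x _; exact: sqr_distV_nondecreasing.
Qed.

Lemma integral_sqr_distV_le (mu : {measure set mR -> \bar R}) y n :
  (\int[mu]_x ((sqr_dist (approach y n) x)^-1)%:E <= \int[mu]_x inv_sqr_dist y x)%E.
Proof.
have nd : {homo (fun k => \int[mu]_x ((sqr_dist (approach y k) x)^-1)%:E)%E :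
    k m / (k <= m)%N >-> (k <= m)%E}.
  move=> k m km; apply: ge0_le_integral => //.
  - by move=> x _; rewrite lee_fin invr_ge0 sqr_dist_ge0.
  - apply/measurable_EFinP; apply: measurable_sqr_distV.
    exact: Im_approach_neq0.
  - apply/measurable_EFinP; apply: measurable_sqr_distV.
    exact: Im_approach_neq0.
  - by move=> x _; exact: sqr_distV_nondecreasing.
have /(cvg_unique _ (integral_inv_sqr_dist (mu := mu) (y := y))) -> // :=
  ereal_nondecreasing_cvgn nd.
by apply: ereal_sup_ubound; exists n.
Qed.

Lemma integral_inv_sqr_dist_le (mu : {measure set mR -> \bar R}) y (C : \bar R) :
  (forall n, \int[mu]_x ((sqr_dist (approach y n) x)^-1)%:E <= C)%E ->
  (\int[mu]_x inv_sqr_dist y x <= C)%E.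
Proof.
move=> leC; have <- := cvg_lim _ (integral_inv_sqr_dist (mu := mu) (y := y)) => //.
apply: lime_le; last exact: nearW.
by apply/cvg_ex; eexists; exact: integral_inv_sqr_dist.
Qed.

End inverse_square_distance.

Section weyl_function.
Context {R : realType} {H : hilbertType R} {M : set H}.
Variables (A : set (H * H)) (E : spectral_family M) (u : H).
Hypotheses (M_subspace : subspace M) (A_subspace : subspace A).
Hypothesis A_symmetric : symmetric_operator A.
Hypothesis A_spectral : is_spectral_family_of A E.
Hypotheses (Mu : M u) (u_unit : hnorm u = 1).
Local Notation nu := (spectral_measure E).
Local Notation mR := (measurableTypeR R).
Local Notation mu := (weighted_measure (nu u)).
Implicit Types (z : R[i]).

Let measurable_weight : measurable_fun setT (fun x : mR => 1 + (x : R) ^+ 2).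
Proof. by apply: measurable_funD => //; exact: measurable_sqr_mR. Qed.

Section resolvent_vector.
Variables (z : R[i]) (v : H).
Hypotheses (z0 : complex.Im z != 0) (Av : A (v, u + z *: v)).

Let Mv : M v. Proof. exact: (dom_operator_mem A_spectral Av). Qed.

(** [v] is the resolvent at [z] applied to [u]. *)
Lemma spectral_measure_resolvent : has_density (nu u) (nu v) (sqr_dist z).
Proof.
have Mzv : M (u + z *: v).
  by apply: (subspaceD M_subspace) => //; exact: (subspaceZ _ M_subspace).
have := spectral_measure_image M_subspace A_subspace A_symmetric A_spectral z Av Mzv.
by rewrite addrK.
Qed.

Lemma integral_weighted_measure (f : mR -> R) : measurable_fun setT f ->
  (\int[mu]_x (f x)%:E =
   \int[nu v]_x (f x * (1 + x ^+ 2) * sqr_dist z x)%:E)%E.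
Proof.
move=> mf.
have w0 (x : mR) : 0 <= 1 + (x : R) ^+ 2 by rewrite addr_ge0// sqr_ge0.
have muE : has_density mu (nu u) (fun x : mR => 1 + (x : R) ^+ 2) by [].
apply: etrans (integral_density w0 measurable_weight muE mf) _.
apply: integral_density spectral_measure_resolvent _.
- exact: sqr_dist_ge0.
- exact: measurable_sqr_dist.
- exact: measurable_funM.
Qed.

Lemma Rintegral_quadratic (c2 c1 c0 : R) :
  (\int[nu v]_x (c2 * x ^+ 2 + (c1 * x + c0)) =
   c2 * \int[nu v]_x (x ^+ 2) + (c1 * \int[nu v]_x x + c0 * hnorm v ^+ 2))%R.
Proof.
have i2 := integrable_sqr A_spectral Av; have i1 := integrable_id A_spectral Av.
have i0 : (nu v).-integrable setT (EFin \o (fun x : mR => c0 : R)).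
  apply/integrableP; split; first exact: measurable_cst.
  by rewrite integral_cst//= lte_mul_pinfty// spectral_measure_lty.
have i2' := integrableZl measurableT c2 i2.
have i1' := integrableZl measurableT c1 i1.
rewrite RintegralD//; last exact: (integrableD measurableT i1' i0).
rewrite RintegralD// !RintegralZl// Rintegral_cst//.
by rewrite spectral_measure_setT.
Qed.

(** Total mass of the two sides of [spectral_measure_resolvent]. *)
Lemma second_moment : (\int[nu v]_x (x ^+ 2))%R =
  1 + 2 * complex.Re z * (\int[nu v]_x x)%R - modulus z ^+ 2 * hnorm v ^+ 2.
Proof.
have := spectral_measure_resolvent measurableT.
rewrite spectral_measure_setT// u_unit expr1n => /(congr1 fine)/=.
set s := complex.Re z; set t := complex.Im z.
have -> : fine (\int[nu v]_x (sqr_dist z x)%:E) =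
    (\int[nu v]_x (1 * x ^+ 2 + (- (2 * s) * x + (s ^+ 2 + t ^+ 2))))%R.
  by apply: eq_Rintegral => x _; rewrite /sqr_dist -/s -/t; ring.
rewrite Rintegral_quadratic modulus_sqr -/s -/t; lra.
Qed.

Lemma dot_resolvent : dot v u =
  (\int[nu v]_x x)%R%:C - conjC z * (hnorm v ^+ 2)%:C.
Proof.
have := congr1 conjC (dot_operator A_spectral Av).
rewrite dot_conj dotDr dotZr dot_sqr => /eqP.
rewrite -subr_eq0 => /eqP h.
apply/eqP; rewrite -subr_eq0; apply/eqP; rewrite -[RHS]h.
have -> : conjC (\int[nu v]_x x)%R%:C = (\int[nu v]_x x)%R%:C :> R[i].
  exact: conjc_real.
by ring.
Qed.

(** Against the spectral measure of [v] the integrand becomes a polynomial of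
    degree two, since (1 + x^2) |x - z|^2 cancels the denominators, and the
    moments of that measure are known. *)
Lemma borel_transform_resolvent :
  borel_transform mu z = z + (1 + z ^+ 2) * dot v u.
Proof.
have sd0 (x : mR) : sqr_dist z x != 0 by rewrite gt_eqF// sqr_dist_gt0.
have x20 (x : mR) : 1 + (x : R) ^+ 2 != 0 by rewrite gt_eqF// ltr_pwDl// sqr_ge0.
have ReV (x : R) : complex.Re (x%:C - z)^-1 = (x - complex.Re z) / sqr_dist z x.
  by rewrite /sqr_dist; case: (z) => a b /=; rewrite sub0r sqrrN.
have ImV (x : R) : complex.Im (x%:C - z)^-1 = complex.Im z / sqr_dist z x.
  by rewrite /sqr_dist; case: (z) => a b /=; rewrite sub0r sqrrN mulNr opprK.
have mV := measurable_sqr_distV z0.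
have mW : measurable_fun setT (fun x : mR => (1 + (x : R) ^+ 2)^-1).
  have i0 : complex.Im ('i%C : R[i]) != 0 by rewrite /= oner_eq0.
  have := measurable_sqr_distV i0; congr measurable_fun.
  by apply/funext => x; rewrite /sqr_dist/= subr0 expr1n addrC.
set I1 := (\int[nu v]_x x)%R; set I2 := (\int[nu v]_x (x ^+ 2))%R.
set a := complex.Re z; set b := complex.Im z.
have ReF : (\int[mu]_x complex.Re ((x%:C - z)^-1 - (x / (1 + x ^+ 2))%:C))%R =
    a * I2 + ((1 - (a ^+ 2 + b ^+ 2)) * I1 + (- a) * hnorm v ^+ 2).
  rewrite -Rintegral_quadratic /Rintegral integral_weighted_measure; last first.
    apply: (@eq_measurable_fun _ _ _ _ setT
      (fun x : mR => (x - a) * (sqr_dist z x)^-1 - x * (1 + (x : R) ^+ 2)^-1)).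
      by move=> x _; rewrite ReD ReN ReV.
    apply: measurable_funB; apply: measurable_funM => //.
    exact: measurable_shift_mR.
  congr fine; apply: eq_integral => x _; congr (_%:E).
  rewrite ReD ReN ReV /= -/a; have := sd0 x; have := x20 x.
  rewrite /sqr_dist -/a -/b => h1 h2; field; apply/andP; split => //.
have ImF : (\int[mu]_x complex.Im ((x%:C - z)^-1 - (x / (1 + x ^+ 2))%:C))%R =
    b * I2 + (0 * I1 + b * hnorm v ^+ 2).
  rewrite -Rintegral_quadratic /Rintegral integral_weighted_measure; last first.
    apply: (@eq_measurable_fun _ _ _ _ setT
      (fun x : mR => b * (sqr_dist z x)^-1)).
      by move=> x _; rewrite ImD ImN ImV subr0.
    exact: measurable_funM.
  congr fine; apply: eq_integral => x _; congr (_%:E).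
  rewrite ImD ImN ImV /= -/b subr0; have := sd0 x => h2.
  by field.
rewrite /borel_transform ReF ImF dot_resolvent -/I1 /I2 second_moment -/I1.
apply: complex_ext; rewrite /= !(expr2, ReD, ImD, ReM, ImM, ReN, ImN, Re_conj, Im_conj)/=.
  by rewrite -/a -/b -!expr2 modulus_sqr -/a -/b; ring.
by rewrite -/a -/b -!expr2 modulus_sqr -/a -/b; ring.
Qed.

Lemma integral_sqr_distV_resolvent :
  (\int[mu]_x ((sqr_dist z x)^-1)%:E)%E =
  (hnorm v ^+ 2 + (\int[nu v]_x (x ^+ 2))%R)%:E.
Proof.
rewrite integral_weighted_measure; last exact: measurable_sqr_distV.
transitivity (\int[nu v]_x (1 * x ^+ 2 + (0 * x + 1))%:E)%E.
  apply: eq_integral => x _; congr (_%:E).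
  by rewrite mulrC mulrA divff ?gt_eqF ?sqr_dist_gt0// !mul1r mul0r add0r addrC.
rewrite -[LHS]fineK.
  congr (_%:E); rewrite -/(Rintegral _ _ _) Rintegral_quadratic; ring.
apply: integrable_fin_num => //.
apply: (integrable_quadratic A_spectral (c := 1) Av) => [|x].
  apply: measurable_funD; first by apply: measurable_funM => //; exact: measurable_sqr_mR.
  by apply: measurable_funD => //; exact: measurable_funM.
by rewrite !mul1r mul0r add0r addrC ger0_norm// addr_ge0 ?sqr_ge0.
Qed.

End resolvent_vector.
End weyl_function.

(** * Boundary values on the real line *)

Section boundary_values.
Context {R : realType} {H : hilbertType R} (T : set (H * H)) (M : set H) (u : H).
Hypothesis T_self_adjoint : self_adjoint T.
Hypotheses (M_subspace : subspace M) (M_closed : seq_closed M).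
Hypotheses (Mu : M u) (u_unit : hnorm u = 1).
Hypothesis M_resolvent : forall z v, complex.Im z != 0 ->
  T (v, u + z *: v) -> M v.
Variable E : spectral_family M.
Hypothesis E_spectral : is_spectral_family_of (op_restrict T M) E.
Local Notation mR := (measurableTypeR R).
Local Notation mu := (weighted_measure (spectral_measure E u)).
Implicit Types (y e : R) (z : R[i]) (g v w : H).

Let A := op_restrict T M.

Let TS : subspace T. Proof. by case: T_self_adjoint. Qed.
Let Tsym : symmetric_operator T. Proof. by case: T_self_adjoint. Qed.

Lemma op_restrict_subspace : subspace A.
Proof.
split; first by split; [exact: TS.1 | exact: M_subspace.1].
by move=> c p q [Tp Mp] [Tq Mq]; split; [exact: TS.2 | exact: M_subspace.2].
Qed.

Lemma op_restrict_symmetric : symmetric_operator A.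
Proof. by move=> p q [Tp _] [Tq _]; exact: Tsym. Qed.

Lemma resolvent_exists z : complex.Im z != 0 -> exists2 v, M v & T (v, u + z *: v).
Proof.
move=> z0; have [v Tv] := self_adjoint_range u T_self_adjoint z0.
by exists v => //; exact: M_resolvent Tv.
Qed.

Section limit_point.
Variables (y : R) (g : H).
Hypothesis Tg : T (g, u + y%:C *: g).

Let upper e : R[i] := y +i* e.

(** v - g is the resolvent at y + i e applied to i e g. *)
Lemma resolvent_near e v : 0 < e -> T (v, u + upper e *: v) ->
  hnorm (v - g) <= hnorm g.
Proof.
move=> e0 Tv; have := symmetric_shift_ge (upper e) Tsym (subspaceB TS Tv Tg).
have -> : u + upper e *: v - (u + y%:C *: g) - upper e *: (v - g) =
    (upper e - y%:C) *: g by module_ring.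
have -> : upper e - y%:C = 0 +i* e.
  by apply: complex_ext; rewrite /= ?subrr ?subr0.
rewrite hnormZ /= gtr0_norm//.
have -> : modulus (0 +i* e) = e.
  by rewrite /modulus normc_def/= expr0n add0r sqrtr_sqr gtr0_norm.
by rewrite ler_pM2l.
Qed.

Lemma resolvent_hnorm_le e v : 0 < e -> T (v, u + upper e *: v) ->
  hnorm v <= 2 * hnorm g.
Proof.
move=> e0 Tv; have := resolvent_near e0 Tv.
by have := hnorm_triangle (v - g) g; rewrite subrK; lra.
Qed.

(** Move T - y from g to v - g in (v - g, u), as u = (T - y) g. *)
Lemma dot_resolvent_limit e v : T (v, u + upper e *: v) ->
  dot v u - dot g u = (0 +i* e) * dot v g.
Proof.
move=> Tv; have /= := Tsym (subspaceB TS Tv Tg) Tg.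
rewrite !dotE.
have -> : conjC y%:C = y%:C :> R[i] by exact: conjc_real.
have -> : upper e = y%:C + (0 +i* e).
  by apply: complex_ext; rewrite /= ?addr0 ?add0r.
move=> /eqP; rewrite -subr_eq0 => /eqP h.
by apply/eqP; rewrite -subr_eq0 -oppr_eq0; apply/eqP; rewrite -[RHS]h; ring.
Qed.

(** By [resolvent_hnorm_le] the resolvent vectors are bounded, so
    [dot_resolvent_limit] controls the difference by a multiple of [e]. *)
Lemma borel_transform_limit :
  (borel_transform mu (y +i* e) : R[i]^o) @[e --> 0^'+] -->
    (y%:C + (1 + y%:C ^+ 2) * dot g u : R[i]^o).
Proof.
pose K := 1 + (2 * `|y| + 1) * (2 * hnorm g) + (1 + y ^+ 2) * (2 * hnorm g * hnorm g).
have K0 : 0 < K.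
  rewrite /K; have := hnorm_ge0 g; have := normr_ge0 y; have := sqr_ge0 y => y2 y1 g0.
  have h1 : 0 <= (2 * `|y| + 1) * (2 * hnorm g) by rewrite mulr_ge0//; lra.
  have h2 : 0 <= (1 + y ^+ 2) * (2 * hnorm g * hnorm g).
    by rewrite !mulr_ge0//; lra.
  by rewrite -addrA ltr_pwDl// addr_ge0.
apply/(@cvgrPdist_lt _ R[i]^o) => d d0.
have dr : d = (complex.Re d)%:C by rewrite RRe_real// gtr0_real.
have d0' : 0 < complex.Re d by rewrite -ltcR -dr.
near=> e.
have e0 : 0 < e by near: e; exact: nbhs_right_gt.
have e1 : e < 1 by near: e; exact: nbhs_right_lt.
have eK : e < complex.Re d / K by near: e; apply: nbhs_right_lt; rewrite divr_gt0.
have z0 : complex.Im (upper e) != 0 by rewrite /= gt_eqF.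
have [v Mv Tv] := resolvent_exists z0.
have Av : A (v, u + upper e *: v) by [].
have := borel_transform_resolvent M_subspace op_restrict_subspace
  op_restrict_symmetric E_spectral Mu u_unit z0 Av.
rewrite -/(upper e) => ->.
rewrite modulusE dr ltcR.
apply: le_lt_trans (_ : e * K < _); last by rewrite -ltr_pdivlMr.
have zE : upper e = y%:C + (0 +i* e).
  by apply: complex_ext; rewrite /= ?addr0 ?add0r.
have /eqP := dot_resolvent_limit Tv; rewrite subr_eq => /eqP vu.
set ie : R[i] := 0 +i* e in zE vu.
have mie : modulus ie = e.
  by rewrite /modulus normc_def/= expr0n add0r sqrtr_sqr gtr0_norm.
have -> : y%:C + (1 + y%:C ^+ 2) * dot g u - (upper e + (1 + upper e ^+ 2) * dot v u) =
    - (ie * (1 + ((2 * y%:C + ie) * dot v u + (1 + y%:C ^+ 2) * dot v g))).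
  by rewrite zE vu; ring.
rewrite modulusN modulusM mie ler_pM2l//.
have vle := resolvent_hnorm_le e0 Tv.
have m1 : modulus (1 : R[i]) = 1 by rewrite /modulus normr1.
have m2 : modulus (2 * y%:C + ie) <= 2 * `|y| + 1.
  rewrite (le_trans (modulus_triangle _ _))// mie lerD ?(ltW e1)//.
  rewrite modulusM modulus_real -[2 : R[i]](rmorph_nat (real_complex R) 2).
  by rewrite modulus_real ger0_norm.
have m3 : modulus (1 + y%:C ^+ 2 : R[i]) = 1 + y ^+ 2.
  rewrite -(rmorph1 (real_complex R)) -rmorphXn -rmorphD modulus_real.
  by rewrite ger0_norm// addr_ge0// sqr_ge0.
have c1 := cauchy_schwarz v u; rewrite u_unit mulr1 in c1.
have c2 := cauchy_schwarz v g.
rewrite (le_trans (modulus_triangle _ _))// m1 /K -addrA lerD2l.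
rewrite (le_trans (modulus_triangle _ _))// !modulusM m3 lerD//.
  apply: ler_pM; rewrite ?modulus_ge0//; exact: le_trans c1 vle.
rewrite ler_wpM2l ?addr_ge0 ?sqr_ge0// (le_trans c2)//.
by rewrite ler_wpM2r ?hnorm_ge0.
Unshelve. all: by end_near.
Qed.

(** Monotone convergence, the approximating integrals being bounded by the norms
    of the resolvent vectors. *)
Lemma integral_inv_sqr_dist_lty : (\int[mu]_x inv_sqr_dist y x < +oo)%E.
Proof.
pose K := 2 * hnorm g.
have K0 : 0 <= K by rewrite mulr_ge0// hnorm_ge0.
pose C := K ^+ 2 + (1 + 2 * `|y| * (K + `|y| * K ^+ 2)).
apply: (@le_lt_trans _ _ C%:E); last exact: ltry.
apply: integral_inv_sqr_dist_le => n.
have z0 := Im_approach_neq0 y n.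
have [v Mv Tv] := resolvent_exists z0.
have Av : A (v, u + approach y n *: v) by [].
rewrite (integral_sqr_distV_resolvent M_subspace op_restrict_subspace
  op_restrict_symmetric E_spectral Mu z0 Av) lee_fin.
rewrite (second_moment M_subspace op_restrict_subspace
  op_restrict_symmetric E_spectral Mu u_unit Av).
have := congr1 (@complex.Re R) (dot_resolvent E_spectral Av).
have vK : hnorm v <= K := resolvent_hnorm_le (Im_approach_gt0 y n) Tv.
rewrite ReD ReN ReM Re_conj Im_conj/= mulr0 subr0.
set I1 := Rintegral _ _ _ => h.
have Ile : `|I1| <= K + `|y| * K ^+ 2.
  have -> : I1 = complex.Re (dot v u) + y * hnorm v ^+ 2 by rewrite h subrK.
  rewrite (le_trans (ler_normD _ _))// lerD//.
    rewrite (le_trans (Re_le_modulus _))// (le_trans (cauchy_schwarz _ _))//.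
    by rewrite u_unit mulr1.
  rewrite normrM ler_wpM2l// ger0_norm ?sqr_ge0//.
  by rewrite ler_pXn2r// ?nnegrE ?hnorm_ge0.
have v2 : hnorm v ^+ 2 <= K ^+ 2 by rewrite ler_pXn2r// ?nnegrE ?hnorm_ge0.
rewrite /C lerD//.
rewrite (le_trans _ (_ : 1 + 2 * y * I1 <= _))//.
  by rewrite gerDl oppr_le0 mulr_ge0// sqr_ge0.
rewrite lerD2l (le_trans (ler_norm _))// !normrM [`|2|]ger0_norm//.
by rewrite ler_wpM2l ?mulr_ge0.
Qed.

End limit_point.

Lemma Im_dot_resolvent y e v : T (v, u + (y +i* e) *: v) ->
  complex.Im (dot v u) = e * hnorm v ^+ 2.
Proof.
move=> Tv; have /= := congr1 (@complex.Im R) (Tsym Tv Tv).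
rewrite !dotE dot_sqr !(ImD, ImM, Im_conj, Re_conj)/= -dot_conj Im_conj.
by rewrite !mulr0 !add0r; lra.
Qed.

(** The real part of (v, w) is the average of |v|^2 and |w|^2 with weights e and
    e'. As a consequence |v|^2 decreases with e, and |v - w|^2 is at most the
    variation of the squared norms. *)
Lemma resolvent_gap y e e' v w :
  T (v, u + (y +i* e) *: v) -> T (w, u + (y +i* e') *: w) ->
  (e + e') * hnorm (v - w) ^+ 2 = (e' - e) * (hnorm v ^+ 2 - hnorm w ^+ 2).
Proof.
move=> Tv Tw; have /= := congr1 (@complex.Im R) (Tsym Tv Tw).
rewrite !dotE !(ImD, ImM, Im_conj, Re_conj)/= -(dot_conj w u) Im_conj.
rewrite (Im_dot_resolvent Tv) (Im_dot_resolvent Tw) hnorm_sqrB => h.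
have {}h : (e + e') * complex.Re (dot v w) = e * hnorm v ^+ 2 + e' * hnorm w ^+ 2.
  by lra.
have -> : (e + e') * (hnorm v ^+ 2 + hnorm w ^+ 2 - 2 * complex.Re (dot v w)) =
  (e + e') * (hnorm v ^+ 2 + hnorm w ^+ 2) - 2 * ((e + e') * complex.Re (dot v w)) by ring.
by rewrite h; ring.
Qed.

(** The squared norms of the resolvent vectors at y + i / (n + 1) are bounded by
    the integral and increase, so [resolvent_gap] makes the vectors Cauchy; the
    graph of [T] is closed. *)
Lemma resolvent_boundary_value y : (\int[mu]_x inv_sqr_dist y x < +oo)%E ->
  exists2 g, M g & T (g, u + y%:C *: g).
Proof.
move=> finy; have y0 : (0 <= \int[mu]_x inv_sqr_dist y x)%E.
  apply: integral_ge0 => x _; rewrite /inv_sqr_dist; case: ifP => // _.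
  by rewrite lee_fin invr_ge0 sqr_ge0.
pose C := fine (\int[mu]_x inv_sqr_dist y x)%E.
have CE : (\int[mu]_x inv_sqr_dist y x)%E = C%:E by rewrite fineK// ge0_fin_numE.
have /choice[v vP] n : exists v, M v /\ T (v, u + approach y n *: v).
  by have [v Mv Tv] := resolvent_exists (Im_approach_neq0 y n); exists v.
have mC n : hnorm (v n) ^+ 2 <= C.
  have [Mv Tv] := vP n; have Av : A (v n, u + approach y n *: v n) by [].
  rewrite -lee_fin -CE; apply: le_trans (integral_sqr_distV_le _ _ n).
  rewrite (integral_sqr_distV_resolvent M_subspace op_restrict_subspace
    op_restrict_symmetric E_spectral Mu (Im_approach_neq0 y n) Av) lee_fin.
  by rewrite lerDl Rintegral_ge0// => x _; rewrite sqr_ge0.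
have gap n k : (k < n)%N ->
    hnorm (v n - v k) ^+ 2 <= hnorm (v n) ^+ 2 - hnorm (v k) ^+ 2.
  move=> kn; have := resolvent_gap (vP n).2 (vP k).2.
  have a0 : 0 < n.+1%:R^-1 :> R by rewrite invr_gt0.
  have ab : n.+1%:R^-1 < k.+1%:R^-1 :> R by rewrite ltf_pV2 ?posrE// ltr_nat.
  move: a0 ab (sqr_ge0 (hnorm (v n - v k))).
  set a := n.+1%:R^-1; set b := k.+1%:R^-1; set s := hnorm (v n - v k) ^+ 2.
  set q := _ - _ => a0 ab s0 h.
  rewrite -(@ler_pM2l _ (b - a)) ?subr_gt0// -h ler_wpM2r//; lra.
pose S := [set hnorm (v n) ^+ 2 | n in [set: nat]].
have hS : has_sup S.
  split; first by exists (hnorm (v 0%N) ^+ 2), 0%N.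
  by exists C => _ [n _ <-].
have leS n : hnorm (v n) ^+ 2 <= sup S by apply: sup_upper_bound => //; exists n.
have [g vg] : exists g, hlim v g.
  apply: hilbert_complete => d d0.
  have d2 : 0 < d ^+ 2 by rewrite exprn_gt0.
  have [_ [N _ <-] NP] := sup_adherent d2 hS.
  have close n k : (N <= k)%N -> (k < n)%N -> hnorm (v n - v k) < d.
    move=> Nk kn; rewrite -(@ltr_pXn2r _ 2)// ?nnegrE ?hnorm_ge0 ?ltW//.
    have := gap _ _ kn; have := leS n.
    have : hnorm (v N) ^+ 2 <= hnorm (v k) ^+ 2.
      have [->//|] := eqVneq N k; rewrite neq_ltn [(k < N)%N]ltnNge Nk orbF => Nk'.
      by have := gap _ _ Nk'; have := sqr_ge0 (hnorm (v k - v N)); lra.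
    lra.
  exists N => m n Nm Nn; case: (ltngtP m n) => [mn|nm|->].
  - by rewrite hnormB; exact: close.
  - exact: close.
  - by rewrite subrr hnorm0.
exists g; first by apply: M_closed vg => n; exact: (vP n).1.
apply: (self_adjoint_closed T_self_adjoint (fun n => (vP n).2) vg).
have -> : (fun n => u + approach y n *: v n) =
    (fun n => u + (y%:C *: v n + (0 +i* n.+1%:R^-1) *: v n)).
  apply/funext => n; rewrite -scalerDl; congr (_ + _ *: _).
  by apply: complex_ext; rewrite /= ?addr0 ?add0r.
apply: hlimD; first exact: hlim_cst.
rewrite -[X in hlim _ X]addr0; apply: hlimD; first exact: hlimZ.
move=> d d0; have C0 : 0 <= C by exact: le_trans (sqr_ge0 _) (mC 0%N).
have [|N NP] := @invS_lt R (d / (C + 1)); first by rewrite divr_gt0// ltr_wpDl.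
exists N => n /NP; rewrite subr0 hnormZ ltr_pdivlMr ?ltr_wpDl//.
have -> : modulus (0 +i* n.+1%:R^-1 : R[i]) = n.+1%:R^-1.
  by rewrite /modulus normc_def/= expr0n add0r sqrtr_sqr gtr0_norm// invr_gt0.
apply: le_lt_trans; rewrite ler_pM2l ?invr_gt0//.
have := mC n; have := hnorm_ge0 (v n); nra.
Qed.

End boundary_values.

(** * Eigenvalues of the extensions *)

Theorem theorem4p1 (R : realType) (H : hilbertType R) (B : set (H * H))
    (B_linear : linear_operator B)
    (B_dense : densely_defined B)
    (B_closed : closed B)
    (B_symmetric : symmetric_operator B)
    (defect_plus : one_dimensional (deficiency_plus B))
    (defect_minus : one_dimensional (deficiency_minus B))
    (up um : H)
    (up_defect : deficiency_plus B up) (up_unit : `|up| = 1)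
    (um_defect : deficiency_minus B um) (um_unit : `|um| = 1)
    (* the cyclicity space does not depend on the parameter t1 *)
    (t1 : R) (t1_range : 0 <= t1 < pi) (M : set H)
    (M_def : M = cyclicity_space B up um t1)
    (t0 : R) (t0_range : 0 <= t0 < pi)
    (E0 : spectral_family M)
    (E0_spectral : is_spectral_family_of (op_restrict (extension B up um t0) M) E0) :
  let mu0 := weighted_measure (spectral_measure E0 up) in
  forall t : R, 0 <= t < pi -> t <> t0 ->
    point_spectrum (op_restrict (extension B up um t) M) =
    [set y%:C | y in [set y : R |
       (\int[mu0]_x inv_sqr_dist y x < +oo)%E /\
       (borel_transform mu0 (y +i* e) : R[i]^o) @[e --> 0^'+]
         --> ((cot (t - t0))%:C : R[i]^o)]].
Proof.
move=> mu0 t t_range tt0.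
have BS : subspace B.
  by have [B0 BL _] := B_linear; split=> // c p q; exact: BL.
have Bc := closed_graph_closed B_closed.
have up1 : hnorm up = 1 by apply: complexI; rewrite -hnormE.
have um1 : hnorm um = 1 by apply: complexI; rewrite -hnormE.
have s0 := sin_neq0_range t_range t0_range tt0.
have SA s : self_adjoint (extension B up um s) by exact: ext_self_adjoint.
rewrite M_def in E0 E0_spectral mu0 *.
have MS := cyclicity_space_subspace B up um t1.
have Mup : cyclicity_space B up um t1 up by exact: up_cyclicity_space.
have Mres z v : complex.Im z != 0 ->
    extension B up um t0 (v, up + z *: v) -> cyclicity_space B up um t1 v.
  by move=> z0 Tv; exact: resolvent_cyclicity_space z0 Tv.
apply/seteqP; split=> [z [v v0 [Tv Mv]]|_ [y [finy limy] <-]].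
  have zE : z = (complex.Re z)%:C.
    have [_ Tsym _ _] := SA t.
    have := symmetric_eigenvalue_real Tsym Tv v0.
    by case: (z) => a b /= ->.
  rewrite zE in Tv *; set y := complex.Re z in Tv *.
  have [g Tg Fg] : exists2 g, extension B up um t0 (g, up + y%:C *: g) &
      y%:C + (1 + y%:C ^+ 2) * dot g up = (cot (t - t0))%:C.
    by apply: eigenvector_to_boundary_value s0 v0 Mv Tv.
  exists y => //; split.
    exact: (integral_inv_sqr_dist_lty (SA t0) MS Mup up1 Mres E0_spectral Tg).
  rewrite -Fg.
  exact: (borel_transform_limit (SA t0) MS Mup up1 Mres E0_spectral Tg).
have Mc := cyclicity_space_closed (B := B) (up := up) (um := um) (t := t1).
have [g Mg Tg] := resolvent_boundary_value (SA t0) MS Mc Mup Mres E0_spectral finy.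
have limg := borel_transform_limit (SA t0) MS Mup up1 Mres E0_spectral Tg.
have Fg : y%:C + (1 + y%:C ^+ 2) * dot g up = (cot (t - t0))%:C.
  exact: (cvg_unique _ limg limy).
exists (up + (y%:C - 'i%C) *: g).
  by apply: weyl_neq0 Tg.
split; first by apply: boundary_value_to_eigenvector s0 Tg Fg.
by apply: (subspaceD MS) => //; exact: (subspaceZ _ MS).
Qed.
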